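(* Let $H$ be a complex Hilbert space and let $M_0,M_1\in L(H)$ be such that $R(M_0)$ is closed and the linear operator pencil $\mathcal{M}$ associated with $(M_0,M_1)$ is regular. Then $\mathcal{M}$ admits a strong exponential dichotomy if, and only if, $$\sigma_{\mathrm{IV}}(\mathcal{M})\cap\mathrm{i}\mathbb{R}=\sigma\left(-\left(\iota_{R(M_0)}^{*}M_0\iota_{\mathrm{IV}}\right)^{-1}\left(\iota_{R(M_0)}^{*}M_1\iota_{\mathrm{IV}}\right)\right)\cap\mathrm{i}\mathbb{R}=\emptyset.$$ The pencil $\mathcal{M}$ is strongly exponentially stable if, and only if, $\sigma_{\mathrm{IV}}(\mathcal{M})\subseteq\{z\in\mathbb{C}:\operatorname{Re}z<0\}$.
   Context: $L(H)$ is the space of bounded linear operators on $H$; $R(M_0)$ denotes the range. For a closed subspace $S\subseteq H$, $\iota_S:S\hookrightarrow H$ is the canonical embedding and $\iota_S^{*}:H\to S$ its adjoint (the orthogonal projection onto $S$). The linear operator pencil associated with $(M_0,M_1)$ is $\mathcal{M}(z)=zM_0+M_1$, $z\in\mathbb{C}$. It is called regular (of index $0$) if there is $\nu\in\mathbb{R}$ such that $zM_0+M_1$ is boundedly invertible for all $z$ with $\operatorname{Re}z>\nu$ and $z\mapsto(zM_0+M_1)^{-1}\in L(H)$ is bounded on $\{z:\operatorname{Re}z>\nu\}$. Let $\mathrm{IV}:=\{x\in H:M_1x\in R(M_0)\}$, a closed subspace of $H$; the operator $\iota_{R(M_0)}^{*}M_0\iota_{\mathrm{IV}}:\mathrm{IV}\to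 R(M_0)$ is continuously invertible, and $\sigma_{\mathrm{IV}}(\mathcal{M})$ denotes the spectrum of the bounded operator $-(\iota_{R(M_0)}^{*}M_0\iota_{\mathrm{IV}})^{-1}(\iota_{R(M_0)}^{*}M_1\iota_{\mathrm{IV}})$ on $\mathrm{IV}$. For $u_0\in\mathrm{IV}$ the strong solution is the unique continuous $u:\mathbb{R}_{\ge0}\to H$, continuously differentiable on $\mathbb{R}_{>0}$, with $M_0u'(t)+M_1u(t)=0$ for $t>0$ and $u(0)=u_0$; it is $u(t)=\exp\left(-t(\iota_{R(M_0)}^{*}M_0\iota_{\mathrm{IV}})^{-1}(\iota_{R(M_0)}^{*}M_1\iota_{\mathrm{IV}})\right)u_0$. A closed subspace $S\subseteq\mathrm{IV}$ is invariant under $\mathcal{M}$ if for all $u_0\in S$ the strong solution $u$ satisfies $u(t)\in S$ for all $t>0$. $\mathcal{M}$ admits a strong exponential dichotomy if there exist closed subspaces $S,T\subseteq\mathrm{IV}$, both invariant under $\mathcal{M}$, with $S\dotplus T=\mathrm{IV}$ (direct sum: $S+T=\mathrm{IV}$, $S\cap T=\{0\}$), and constants $\rho>0$, $C_1>0$, $C_2>0$ such that for all $t\ge0$: $|u(t)|_H\le C_1e^{-\rho t}|u_0|_H$ if $u_0\in S$, and $|u(t)|_H\ge C_2e^{\rho t}|u_0|_H$ if $u_0\in T$, where $u$ is the strong solution with initial value $u_0$. $\mathcal{M}$ is strongly exponentially stable if this holds with $S=\mathrm{IV}$ and $T=\{0\}$. *)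

(* Defs.v *)
From HB Require Import structures.
From mathcomp Require Import all_boot all_order all_algebra.
From mathcomp Require Import complex.
From mathcomp Require Import all_classical all_reals all_analysis.
From mathcomp Require Import sesquilinear.

Set Implicit Arguments.
Unset Strict Implicit.
Unset Printing Implicit Defensive.

Import Order.TTheory GRing.Theory Num.Theory.
Import numFieldNormedType.Exports.

Local Open Scope classical_set_scope.
Local Open Scope complex_scope.
Local Open Scope ring_scope.

HB.mixin Record isBoundedOperator (K : numFieldType) (X Y : normedModType K)
    (f : X -> Y) := {
  bounded_operator : exists c : K, forall x, `|f x| <= c * `|x|
}.

#[short(type="boundedOp")]
HB.structure Definition BoundedOperator (K : numFieldType)
    (X Y : normedModType K) :=
  {f of @GRing.Linear K X Y *:%R f & @isBoundedOperator K X Y f}.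

Definition spectrum (K : numFieldType) (X : normedModType K) (A : X -> X)
    : set K :=
  [set z | ~ exists N : boundedOp X X,
      cancel (fun x => z *: x - A x) N /\ cancel N (fun x => z *: x - A x)].

HB.mixin Record isHilbert (R : realType) H
    of CompleteNormedModule R[i] H := {
  inner : {dot H for @Num.conj R[i]} ;
  inner_normE : forall x : H, inner x x = `|x| ^+ 2
}.

#[short(type="hilbertType")]
HB.structure Definition Hilbert (R : realType) :=
  {H of CompleteNormedModule R[i] H & isHilbert R H}.

(* Riesz representation makes [adjoint A y] the unique vector of the set. *)
Definition adjoint (R : realType) (X Y : hilbertType R) (A : boundedOp X Y)
    (y : Y) : X :=
  xget 0 [set x' | forall x, inner (A x) y = inner x x'].

Record closedSubspace (R : realType) (H : hilbertType R) := ClosedSubspace {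
  carrier :> set H ;
  carrier0 : carrier 0 ;
  carrierP : forall (a : R[i]) x y,
    carrier x -> carrier y -> carrier (a *: x + y) ;
  carrier_closed : closed carrier
}.

Section subspace_type.
Context (R : realType) (H : hilbertType R) (S : closedSubspace H).

Definition carrier_pred : {pred H} := fun x => x \in carrier S.

Lemma carrier_submod : submod_closed carrier_pred.
Proof.
split=> [|a x y]; first exact/mem_set/carrier0.
by move=> /set_mem Sx /set_mem Sy; exact/mem_set/carrierP.
Qed.

HB.instance Definition _ :=
  GRing.isSubmodClosed.Build _ _ carrier_pred carrier_submod.

Record subspace_type := Subspace {
  iota : H ;
  _ : iota \in carrier_pred
}.

HB.instance Definition _ := [isSub for iota].
HB.instance Definition _ := [Choice of subspace_type by <:].
HB.instance Definition _ := [SubChoice_isSubLmodule of subspace_type by <:].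

Let norm (x : subspace_type) : R[i] := `|iota x|.

Let norm_normD x y : norm (x + y) <= norm x + norm y.
Proof. exact: ler_normD. Qed.

Let norm_normZ (l : R[i]) x : norm (l *: x) = `|l| * norm x.
Proof. exact: normrZ. Qed.

Let norm_eq0 x : norm x = 0 -> x = 0.
Proof. by move/normr0_eq0 => x0; exact/val_inj. Qed.

HB.instance Definition _ :=
  Lmodule_isNormed.Build R[i] subspace_type norm_normD norm_normZ norm_eq0.

Lemma norm_iota (x : subspace_type) : `|iota x| = `|x|.
Proof. by []. Qed.

Let iota_bounded : exists c : R[i], forall x : subspace_type,
  `|iota x| <= c * `|x|.
Proof. by exists 1 => x; rewrite mul1r norm_iota. Qed.

Let iota_linear : linear iota. Proof. by []. Qed.

HB.instance Definition _ :=
  GRing.isLinear.Build R[i] subspace_type H *:%R iota iota_linear.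
HB.instance Definition _ :=
  isBoundedOperator.Build R[i] subspace_type H iota iota_bounded.

Let subspace_complete (F : set_system subspace_type) :
  ProperFilter F -> cauchy F -> cvg F.
Proof.
move=> FF /cauchy_ballP Fc.
have Gc : cauchy (iota @ F).
  apply/cauchy_ballP => e e0; have := Fc e e0.
  move=> [[P Q] /= [FP FQ] PQ].
  exists (iota @` P, iota @` Q) => /=.
    split; [apply: filterS FP|apply: filterS FQ] => x ?; exact: imageP.
  move=> [_ _] /= [[x Px <-] [y Qy <-]].
  have /= := PQ (x, y) (conj Px Qy).
  by rewrite -!ball_normE.
have /cauchy_cvgP/cvg_ex[/= l Gl] := Gc.
have Sl : carrier S l.
  apply: (@closed_cvg _ _ F _ iota (carrier S) _ _ _ Gl).
    exact: carrier_closed.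
  by apply: nearW => x; exact/set_mem/(valP x).
apply/cvg_ex; exists (Subspace (mem_set Sl)).
by apply/cvgrPdist_lt => e e0; move/cvgrPdist_lt: Gl; exact.
Qed.

HB.instance Definition _ :=
  Uniform_isComplete.Build subspace_type subspace_complete.

Definition subspace_inner (x y : subspace_type) : R[i] :=
  inner (iota x) (iota y).

Let subspace_inner_bilinear :
  bilinear_for *%R (@Num.conj R[i] \; *%R) subspace_inner.
Proof.
split=> [z|z] a x y; rewrite /subspace_inner !linearP//=.
by rewrite linearPl.
Qed.

HB.instance Definition _ :=
  bilinear_isBilinear.Build R[i] subspace_type subspace_type R[i] *%R
    (@Num.conj R[i] \; *%R) subspace_inner subspace_inner_bilinear.

Let subspace_inner_herm x y :
  subspace_inner x y = (-1) ^+ false * Num.conj (subspace_inner y x).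
Proof. exact: hermC. Qed.

HB.instance Definition _ := isHermitianSesquilinear.Build R[i] subspace_type
  false (@Num.conj R[i]) subspace_inner subspace_inner_herm.

Let subspace_inner_gt0 x : x != 0 -> 0 < subspace_inner x x.
Proof. by move=> x0; exact: neq0_dnorm_gt0. Qed.

HB.instance Definition _ := isDotProduct.Build R[i] subspace_type
  subspace_inner subspace_inner_gt0.

Let subspace_inner_normE x : subspace_inner x x = `|x| ^+ 2.
Proof. exact: inner_normE. Qed.

HB.instance Definition _ :=
  isHilbert.Build R subspace_type subspace_inner_normE.

End subspace_type.

Lemma boundedOp_continuous (K : numFieldType) (X Y : normedModType K)
  (f : boundedOp X Y) : continuous f.
Proof.
have [c fc] := @bounded_operator _ _ _ f.
apply: bounded_linear_continuous; apply/linear_boundedP.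
near=> r => x; apply: (le_trans (fc x)).
have cx0 : 0 <= c * `|x| := le_trans (normr_ge0 _) (fc x).
rewrite -(ger0_norm cx0) normrM normr_id ler_wpM2r//.
Unshelve. all: by end_near. Qed.

Unset Implicit Arguments.

Section zero_subspace.
Context {R : realType} (H : hilbertType R).

Lemma zero_subspace_closed : closed [set 0 : H].
Proof.
exact/accessible_closed_set1/hausdorff_accessible/norm_hausdorff.
Qed.

Lemma zero_subspaceP (a : R[i]) (x y : H) :
  [set 0 : H] x -> [set 0 : H] y -> [set 0 : H] (a *: x + y).
Proof. by move=> -> ->; rewrite /= scaler0 addr0. Qed.

Definition zero_subspace : closedSubspace H :=
  ClosedSubspace erefl zero_subspaceP zero_subspace_closed.

End zero_subspace.

Section range_and_IV.
Context {R : realType} {H : hilbertType R}.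
Context (M0 M1 : boundedOp H H) (clM0 : closed (range M0)).

Lemma range_subspace0 : range M0 0.
Proof. by exists 0; rewrite ?linear0. Qed.

Lemma range_subspaceP (a : R[i]) (x y : H) :
  range M0 x -> range M0 y -> range M0 (a *: x + y).
Proof. by move=> [u _ <-] [v _ <-]; exists (a *: u + v); rewrite ?linearP. Qed.

Definition range_subspace : closedSubspace H :=
  ClosedSubspace range_subspace0 range_subspaceP clM0.

Definition IV_set : set H := [set x | range M0 (M1 x)].

Lemma IV0 : IV_set 0.
Proof. by rewrite /IV_set /= linear0; exact: range_subspace0. Qed.

Lemma IVP (a : R[i]) (x y : H) : IV_set x -> IV_set y -> IV_set (a *: x + y).
Proof. by rewrite /IV_set /= linearP => ? ?; exact: range_subspaceP. Qed.

Lemma IV_closed : closed IV_set.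
Proof. by apply: preimage_closed clM0 => x _; exact: boundedOp_continuous. Qed.

Definition IV : closedSubspace H := ClosedSubspace IV0 IVP IV_closed.

End range_and_IV.

Section pencil.
Context {R : realType} {H : hilbertType R}.

Definition pencil (M0 M1 : boundedOp H H) (z : R[i]) (x : H) : H :=
  z *: M0 x + M1 x.

Definition regular (M0 M1 : boundedOp H H) : Prop :=
  exists (nu c : R), forall z : R[i], nu < complex.Re z ->
    exists N : boundedOp H H,
      [/\ cancel (pencil M0 M1 z) N, cancel N (pencil M0 M1 z) &
          forall x, `|N x| <= c%:C * `|x|].

Definition iota_star (S : closedSubspace H) : H -> subspace_type S :=
  adjoint (@iota R H S : boundedOp (subspace_type S) H).

Definition compression (S T : closedSubspace H) (M : boundedOp H H)
    (x : subspace_type S) : subspace_type T := iota_star T (M (iota x)).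

(* ['pinv_] is the inverse because the compression of M0 is a bijection
   whenever the pencil is regular. *)
Definition IV_operator (M0 M1 : boundedOp H H) (clM0 : closed (range M0)) :
    subspace_type (IV M0 M1 clM0) -> subspace_type (IV M0 M1 clM0) :=
  fun x => - 'pinv_(fun=> 0) setT
    (compression (IV M0 M1 clM0) (range_subspace M0 clM0) M0)
    (compression (IV M0 M1 clM0) (range_subspace M0 clM0) M1 x).

Definition sigma_IV (M0 M1 : boundedOp H H) (clM0 : closed (range M0)) :
    set R[i] :=
  spectrum (IV_operator M0 M1 clM0).

(* The module H has complex scalars, so the derivative with respect to the
   real variable is spelled out. *)
Definition is_time_derivative (u : R -> H) (t : R) (v : H) : Prop :=
  (h^-1)%:C *: (u (t + h) - u t) @[h --> 0^'] --> v.

Definition strong_solution (M0 M1 : boundedOp H H) (u0 : H) (u : R -> H) :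
    Prop :=
  [/\ {within `[0, +oo[, continuous u},
      u 0 = u0 &
      exists du : R -> H, forall t : R, 0 < t ->
        [/\ is_time_derivative u t (du t),
            {for t, continuous du} &
            M0 (du t) + M1 (u t) = 0]].

Definition invariant (M0 M1 : boundedOp H H) (S : closedSubspace H) : Prop :=
  forall u0 u, carrier S u0 -> strong_solution M0 M1 u0 u ->
    forall t : R, 0 < t -> carrier S (u t).

Definition strong_dichotomy_on (M0 M1 : boundedOp H H)
    (clM0 : closed (range M0)) (S T : closedSubspace H) : Prop :=
  [/\ [/\ S `<=` IV M0 M1 clM0, T `<=` IV M0 M1 clM0,
          invariant M0 M1 S & invariant M0 M1 T],
      [set x + y | x in S & y in T] = IV M0 M1 clM0,
      S `&` T = [set 0] &
      exists rho C1 C2 : R, [/\ 0 < rho, 0 < C1, 0 < C2 &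
        forall u0 u, strong_solution M0 M1 u0 u -> forall t : R, 0 <= t ->
          (carrier S u0 -> `|u t| <= (C1 * expR (- rho * t))%:C * `|u0|) /\
          (carrier T u0 -> (C2 * expR (rho * t))%:C * `|u0| <= `|u t|)]].

Definition strong_exponential_dichotomy (M0 M1 : boundedOp H H)
    (clM0 : closed (range M0)) : Prop :=
  exists S T : closedSubspace H, strong_dichotomy_on M0 M1 clM0 S T.

Definition strongly_exponentially_stable (M0 M1 : boundedOp H H)
    (clM0 : closed (range M0)) : Prop :=
  strong_dichotomy_on M0 M1 clM0 (IV M0 M1 clM0) (zero_subspace H).

End pencil.

(* Main.v *)
Require Import Defs.
From HB Require Import structures.
From mathcomp Require Import all_boot all_order all_algebra.
From mathcomp Require Import complex.
From mathcomp Require Import all_classical all_reals all_analysis.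
From mathcomp Require Import ring lra.

Set Implicit Arguments.
Unset Strict Implicit.
Unset Printing Implicit Defensive.

Import Order.TTheory GRing.Theory Num.Theory.
Import numFieldNormedType.Exports.

Local Open Scope classical_set_scope.
Local Open Scope complex_scope.
Local Open Scope ring_scope.

(** On IV the pencil is an ordinary differential equation. By regularity,
[z (z M0 + M1)^-1] stays bounded, as [z] tends to infinity, on every vector of
the range of [M0]; this range being complete, it is uniformly bounded there
([uniform_boundedness]). It follows that [M0] is bounded below on IV
([IV_coercive]) and maps IV onto its range ([IV_surjective]), so that the
operator [A] on IV is characterized by [M0 (A x) = - M1 x], and the strong
solutions starting in IV are the trajectories of [u' = A u]
([flow_strong_solution], [strong_solution_flow]). What remains concerns a bounded
operator [A] on a Hilbert space.

From a dichotomy to the resolvent ([dichotomy_resolvent]). Let [u] be the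
trajectory of [x] and [w] that of [A x - z x]. Then [A u = z u + w], so the energy
satisfies [(|u|^2)' = 2 Re z |u|^2 + 2 Re <w, u>]. If the norm of [u] halves within
a fixed time although [Re z >= 0], or doubles although [Re z <= 0], then [w], and
hence [A x - z x], cannot be small compared with [x]. Since the projections of a
dichotomy are bounded, [z - A] is bounded below uniformly on the imaginary axis
(in the stable case, on the closed right half-plane). There invertibility
propagates in small steps from large [z], where the Neumann series converges
([resolvent_half_line]).

From the resolvent to a dichotomy ([exponential_dichotomy]). The Cayley transform
[F = (A + a) (A - a)^-1] maps the imaginary axis to the unit circle, so [1 - w F]
is invertible for [|w| = 1]. The average of [(1 - w F)^-1] over the [2^k]-th roots
[w] of [z] is [(1 - z F^(2^k))^-1], and as [k] grows it becomes independent of [z]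
at a geometric rate ([root_average_lipschitz]). Its limit at [z = 1] is an
idempotent [P] commuting with [A] ([circle_mean_exists]): on the range of [P] the
powers [F^(2^k)] tend to zero, and on the kernel their inverses do. Summed along
an orbit of [F], the polarization identity
[|(A + a) y|^2 - |(A - a) y|^2 = 4 a Re <A y, y>] turns this into a Lyapunov
function, the sum of [|F^j u|^2] for [j < 2^k], which grows or decays
exponentially along trajectories ([lyapunov_decay], [lyapunov_growth]). If [1 - w F]
is invertible on the whole closed disc, the same construction for [r F],
[0 <= r <= 1], yields idempotents depending continuously on [r] and equal to [1]
for [r = 0]; thus [P = 1] ([circle_mean_disc]), which is exponential stability. *)

(** * Real-valued norms *)

(** Norms over [R[i]] take complex values; their real parts carry the same
information and are amenable to the order and the calculus of [R]. *)
Lemma eq_ler (R : numDomainType) (x y : R) : x = y -> x <= y.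
Proof. by move=> ->. Qed.

Definition nrm (R : realType) (X : normedModType R[i]) (x : X) : R :=
  complex.Re `|x|.

Definition cabs (R : realType) (z : R[i]) : R := complex.Re `|z|.

Section cabs.
Context {R : realType}.
Implicit Types z w : R[i].

Lemma cabsE z : `|z| = (cabs z)%:C.
Proof. by rewrite /cabs normc_def. Qed.

Lemma cabs_ge0 z : 0 <= cabs z.
Proof. by rewrite -ler0c -cabsE. Qed.

Lemma cabsM z w : cabs (z * w) = cabs z * cabs w.
Proof. by apply: complexI; rewrite rmorphM -!cabsE normrM. Qed.

Lemma cabsV z : cabs z^-1 = (cabs z)^-1.
Proof. by apply: complexI; rewrite fmorphV -!cabsE normfV. Qed.

Lemma cabs_real (r : R) : cabs r%:C = `|r|.
Proof. by rewrite /cabs normc_def /= expr0n addr0 sqrtr_sqr. Qed.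

Lemma cabsN z : cabs (- z) = cabs z.
Proof. by rewrite /cabs normrN. Qed.

Lemma cabsD z w : cabs (z + w) <= cabs z + cabs w.
Proof. by rewrite -lecR rmorphD -!cabsE ler_normD. Qed.

Lemma cabs_eq0 z : (cabs z == 0) = (z == 0).
Proof. by rewrite -(inj_eq (@complexI R)) -cabsE normr_eq0. Qed.

Lemma cabs0 : cabs (0 : R[i]) = 0.
Proof. by apply/eqP; rewrite cabs_eq0. Qed.

Lemma cabs_nat n : cabs (n%:R : R[i]) = n%:R.
Proof. by rewrite /cabs normr_nat -(rmorph_nat (real_complex R)). Qed.

Lemma cabs_i : cabs ('i : R[i]) = 1.
Proof. by rewrite /cabs normc_def/= expr0n expr1n add0r sqrtr1. Qed.

Lemma cabs1 : cabs (1 : R[i]) = 1.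
Proof. by rewrite /cabs normr1. Qed.

Lemma cabs_sqr z : cabs z ^+ 2 = complex.Re z ^+ 2 + complex.Im z ^+ 2.
Proof. by apply: complexI; rewrite add_Re2_Im2 cabsE rmorphXn. Qed.

Lemma Re_le_cabs z : `|complex.Re z| <= cabs z.
Proof.
rewrite -(ler_pXn2r (_ : (0 < 2)%N)) ?nnegrE ?cabs_ge0//.
by rewrite cabs_sqr real_normK ?num_real// lerDl sqr_ge0.
Qed.

Lemma Im_le_cabs z : `|complex.Im z| <= cabs z.
Proof.
rewrite -(ler_pXn2r (_ : (0 < 2)%N)) ?nnegrE ?cabs_ge0//.
by rewrite cabs_sqr real_normK ?num_real// lerDr sqr_ge0.
Qed.

End cabs.

Section nrm.
Context {R : realType} {X : normedModType R[i]}.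
Implicit Types (x y : X) (z : R[i]).

Lemma nrmE x : `|x| = (nrm x)%:C.
Proof.
rewrite /nrm; have : 0 <= `|x| by [].
by rewrite lecE/= => /andP[/eqP im0 _]; case: `|x| im0 => a b /= ->.
Qed.

Lemma nrm_ge0 x : 0 <= nrm x.
Proof. by rewrite -ler0c -nrmE. Qed.

Lemma nrmD x y : nrm (x + y) <= nrm x + nrm y.
Proof. by rewrite -lecR rmorphD/= -!nrmE ler_normD. Qed.

Lemma nrmN x : nrm (- x) = nrm x.
Proof. by rewrite /nrm normrN. Qed.

Lemma nrmB x y : nrm (x - y) <= nrm x + nrm y.
Proof. by rewrite -(nrmN y) nrmD. Qed.

Lemma nrm_distC x y : nrm (x - y) = nrm (y - x).
Proof. by rewrite -nrmN opprB. Qed.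

Lemma nrm_dist x y : nrm x - nrm y <= nrm (x - y).
Proof. by rewrite lerBlDr -{1}(subrK y x) nrmD. Qed.

Lemma nrmZ z x : nrm (z *: x) = cabs z * nrm x.
Proof. by apply: complexI; rewrite rmorphM/= -!nrmE -cabsE normrZ. Qed.

Lemma nrm0 : nrm (0 : X) = 0.
Proof. by rewrite /nrm normr0. Qed.

Lemma nrm0_eq0 x : nrm x = 0 -> x = 0.
Proof. by move=> x0; apply: normr0_eq0; rewrite nrmE x0. Qed.

Lemma nrm_le0_eq0 x : nrm x <= 0 -> x = 0.
Proof. by move=> x0; apply/nrm0_eq0/le_anti; rewrite x0 nrm_ge0. Qed.

Lemma cvg_nrmP {I : Type} (F : set_system I) {FF : Filter F} (f : I -> X) l :
  f @ F --> l <-> forall e : R, 0 < e -> \forall t \near F, nrm (l - f t) < e.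
Proof.
split=> [/cvgrPdist_lt fl e e0|fl].
  have ec0 : 0 < e%:C by rewrite ltcR.
  by apply: filterS (fl _ ec0) => t; rewrite nrmE ltcR.
apply/cvgrPdist_lt => e; rewrite ltcE/= => /andP[/eqP im0 re0].
apply: filterS (fl _ re0) => t tl.
by rewrite nrmE ltcE/= im0 eqxx.
Qed.

Lemma closed_nrm (C : set X) :
  (forall l, (forall e : R, 0 < e -> exists2 x, C x & nrm (l - x) < e) -> C l)
  -> closed C.
Proof.
move=> H l Cl; apply: H => e e0.
have ec0 : 0 < e%:C by rewrite ltcR.
have [x [Cx]] := Cl _ (nbhsx_ballx l _ ec0).
by rewrite -ball_normE/= nrmE ltcR; exists x.
Qed.

Lemma nrm_closed (C : set X) l : closed C ->
  (forall e : R, 0 < e -> exists2 x, C x & nrm (l - x) < e) -> C l.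
Proof.
move=> clC H; apply: clC => B /nbhs_ballP[e/=].
rewrite ltcE/= => /andP[/eqP im0 re0] eB.
have [x Cx xl] := H _ re0; exists x; split=> //; apply: eB.
by rewrite -ball_normE/= nrmE ltcE/= im0 eqxx.
Qed.

End nrm.

Lemma le0_squeeze (R : realType) (a : R) (b : nat -> R) :
  b n @[n --> \oo] --> 0 -> (forall n, a <= b n) -> a <= 0.
Proof.
move=> b0 ab; rewrite -(cvg_lim (@Rhausdorff R) b0)//.
by apply: limr_ge; [exact: cvgP b0 | exact: nearW].
Qed.

Lemma nrm_squeeze (R : realType) (X : normedModType R[i]) (x : X) (K : R)
    (b : nat -> R) :
  b n @[n --> \oo] --> 0 -> (forall n, nrm x <= K * b n) -> x = 0.
Proof.
move=> b0 xb; apply: nrm_le0_eq0.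
apply: le0_squeeze xb; rewrite -[X in _ --> X](mulr0 K).
by apply: cvgM => //; exact: cvg_cst.
Qed.

Section complete.
Context {R : realType} {X : completeNormedModType R[i]}.

Lemma nrm_cauchy_cvg (x : nat -> X) (b : nat -> R) :
  b n @[n --> \oo] --> 0 ->
  (forall n m, (n <= m)%N -> nrm (x m - x n) <= b n) ->
  exists l, forall n, nrm (l - x n) <= b n.
Proof.
move=> b0 xb.
have xc : cvgn x.
  apply/cauchy_cvgP/cauchy_ballP => e.
  rewrite ltcE/= => /andP[/eqP im0 re0].
  have /cvgrPdist_lt/(_ _ (divr_gt0 re0 (ltr0n _ 2)))[N _ Nb] := b0.
  exists (x @` [set n | (N <= n)%N], x @` [set n | (N <= n)%N]).
    by split; exists N => // n Nn; exact: imageP.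
  move=> [_ _] /= [[n Nn <-] [m Nm <-]].
  rewrite -ball_normE/= nrmE ltcE/= im0 eqxx/=.
  have bN : b N < complex.Re e / 2.
    have := Nb N (leqnn N); rewrite sub0r normrN.
    by apply: le_lt_trans; exact: ler_norm.
  rewrite -(subrKA (x N)) (le_lt_trans (nrmD _ _))//.
  have := xb _ _ Nn; have := xb _ _ Nm; rewrite (nrm_distC (x m)).
  by move: bN; lra.
exists (limn x) => n; apply/ler_addgt0Pr => e e0.
have /cvg_nrmP/(_ _ e0)[N _ Nx] := xc.
have := Nx (maxn N n) (leq_maxl _ _); have := xb n (maxn N n) (leq_maxr _ _).
have := nrmD (limn x - x (maxn N n)) (x (maxn N n) - x n).
by rewrite subrKA; lra.
Qed.

(** The tail bound [b] telescopes, which covers geometric and exponential series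
alike. *)
Lemma nrm_telescope_cvg (x : nat -> X) (b : nat -> R) :
  b n @[n --> \oo] --> 0 ->
  (forall n, nrm (x n.+1 - x n) <= b n - b n.+1) ->
  exists l, forall n, nrm (l - x n) <= b n.
Proof.
move=> b0 xb.
have bd : nonincreasing_seq b.
  apply/nonincreasing_seqP => n.
  by rewrite -subr_ge0 (le_trans (nrm_ge0 _) (xb n)).
have bge0 n : 0 <= b n.
  have := nonincreasing_cvgn_ge bd (cvgP _ b0) n.
  by rewrite (cvg_lim (@Rhausdorff R) b0).
apply: nrm_cauchy_cvg => // n m /subnK <-.
suff : nrm (x (m - n + n)%N - x n) <= b n - b (m - n + n)%N.
  by have := bge0 (m - n + n)%N; lra.
elim: (m - n)%N => [|k IH]; first by rewrite add0n !subrr nrm0.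
rewrite addSn -(subrKA (x (k + n)%N)) (le_trans (nrmD _ _))//.
by have := xb (k + n)%N; lra.
Qed.

Lemma nrm_geometric_cvg (x : nat -> X) (C q : R) : 0 <= q < 1 ->
  (forall n, nrm (x n.+1 - x n) <= C * q ^+ n) ->
  exists l, forall n, nrm (l - x n) <= C / (1 - q) * q ^+ n.
Proof.
move=> /andP[q0 q1] xq; apply: nrm_telescope_cvg => [|n].
  rewrite -[X in _ --> X](mulr0 (C / (1 - q))).
  apply: cvgM; first exact: cvg_cst.
  by apply: cvg_expr; rewrite ger0_norm.
have q10 : 1 - q != 0 by lra.
by rewrite (le_trans (xq n))// exprS; apply: eq_ler; field.
Qed.

End complete.

(** * Boundedly invertible operators and the spectrum *)

Lemma subrACA (V : zmodType) (a b c d : V) :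
  (a - b) - (c - d) = (a - c) - (b - d).
Proof. by rewrite !opprB [LHS]addrACA [RHS]addrACA [- b - _]addrC. Qed.

Section linear_facts.
Context {K : numFieldType} {X Y : lmodType K} (f : X -> Y).
Hypothesis lf : linear f.

Lemma lin0 : f 0 = 0.
Proof.
have := lf (-1) 0 0; rewrite scaler0 add0r => /eqP.
by rewrite scaleN1r addNr => /eqP.
Qed.

Lemma linZ a x : f (a *: x) = a *: f x.
Proof. by rewrite -[a *: x]addr0 lf lin0 addr0. Qed.

Lemma linD x y : f (x + y) = f x + f y.
Proof. by rewrite -[x]scale1r lf !scale1r. Qed.

Lemma linN x : f (- x) = - f x.
Proof. by rewrite -scaleN1r linZ scaleN1r. Qed.

Lemma linB x y : f (x - y) = f x - f y.
Proof. by rewrite linD linN. Qed.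

End linear_facts.

Lemma linear_iter (K : numFieldType) (X : lmodType K) (f : X -> X) n :
  linear f -> linear (iter n f).
Proof. by move=> lf a x y; elim: n => //= n ->; rewrite lf. Qed.

Lemma can_linear (K : numFieldType) (X Y : lmodType K) (f : X -> Y)
  (g : Y -> X) : linear f -> cancel f g -> cancel g f -> linear g.
Proof. by move=> lf fK gK a x y; rewrite -{1}(gK x) -{1}(gK y) -lf fK. Qed.

Section bounded.
Context {R : realType}.

(** Operators arise below as inverses and as pointwise limits; they are carried
as plain functions, with linearity and a bound as separate hypotheses. *)
Definition bounded_by (X Y : normedModType R[i]) (c : R) (f : X -> Y) :=
  forall x, nrm (f x) <= c * nrm x.

Definition boundedly_invertible (X Y : normedModType R[i]) (f : X -> Y) :=
  (exists2 M : R, 0 < M & forall x, nrm x <= M * nrm (f x)) /\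
  (forall y, exists x, f x = y).

Lemma bounded_by_iter (X : normedModType R[i]) (c : R) (f : X -> X) n :
  0 <= c -> bounded_by c f -> bounded_by (c ^+ n) (iter n f).
Proof.
move=> c0 fc x; elim: n => [|n IH]; first by rewrite expr0 mul1r.
by rewrite iterS (le_trans (fc _))// exprS -mulrA ler_wpM2l.
Qed.

Lemma boundedly_invertibleP (X Y : normedModType R[i]) (f : X -> Y) :
  linear f -> boundedly_invertible f ->
  exists g : Y -> X, [/\ cancel f g, cancel g f, linear g &
    exists2 M : R, 0 < M & bounded_by M g].
Proof.
move=> lf [[M M0 fM] /choice[g gK]].
have fK : cancel f g.
  move=> x; apply/eqP; rewrite -subr_eq0; apply/eqP/nrm_le0_eq0.
  by rewrite (le_trans (fM _))// (linB lf) gK subrr nrm0 mulr0.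
exists g; split=> //; first exact: can_linear lf fK gK.
by exists M => // y; rewrite (le_trans (fM _))// gK.
Qed.

Lemma boundedOp_bounded (X Y : normedModType R[i]) (f : boundedOp X Y) :
  exists2 c : R, 0 < c & bounded_by c f.
Proof.
have [c fc] := @bounded_operator _ _ _ f.
exists (`|complex.Re c| + 1) => [|x]; first by rewrite ltr_wpDl.
have := fc x; rewrite !nrmE; case: c {fc} => a b.
rewrite lecE/= => /andP[_]; rewrite mulr0 subr0 => /le_trans; apply.
by rewrite ler_wpM2r ?nrm_ge0// ler_wpDr// ler_norm.
Qed.

Lemma spectrumPn (X : normedModType R[i]) (A : X -> X) (z : R[i]) :
  linear A ->
  ~ spectrum A z <-> boundedly_invertible (fun x => z *: x - A x).
Proof.
move=> lA; set f := fun x => _.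
have lf : linear f.
  move=> a x y; rewrite /f lA !scalerDr scalerN !scalerA (mulrC a) opprD.
  by rewrite addrACA.
split=> [/contrapT[N [fN Nf]]|/(boundedly_invertibleP lf)].
  have [c c0 Nc] := boundedOp_bounded N; split=> [|y]; last first.
    by exists (N y); exact: Nf.
  by exists c => // x; rewrite -{1}(fN x); exact: Nc.
move=> [g [fK gK lg [M M0 gM]]]; apply; rewrite /spectrum/=.
have gb : exists c : R[i], forall x, `|g x| <= c * `|x|.
  by exists M%:C => x; rewrite !nrmE -rmorphM lecR.
pose N : boundedOp X X := HB.pack g (GRing.isLinear.Build _ _ _ _ _ lg)
  (isBoundedOperator.Build _ _ _ _ gb).
by exists N.
Qed.

End bounded.

Section neumann.
Context {R : realType} {X : completeNormedModType R[i]}.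

(** The limit of the iteration [x_(n+1) = B x_n + y]. *)
Lemma neumann (B : X -> X) (q : R) y : linear B -> 0 <= q < 1 ->
  bounded_by q B -> exists x, x = B x + y.
Proof.
move=> lB q01 Bq; have /andP[q0 q1] := q01.
pose x n := iter n (fun x => B x + y) 0.
have xE n : x n.+1 = B (x n) + y by [].
have xS n : nrm (x n.+1 - x n) <= nrm y * q ^+ n.
  elim: n => [|n IH]; first by rewrite /x/= (lin0 lB) add0r subr0 mulr1.
  rewrite [x n.+2]xE {2}[x n.+1]xE.
  rewrite opprD addrACA subrr addr0 -(linB lB) (le_trans (Bq _))//.
  by rewrite exprS mulrCA ler_wpM2l.
have [l lx] := nrm_geometric_cvg q01 xS; exists l.
apply/eqP; rewrite -subr_eq0; apply/eqP.
apply: (@nrm_squeeze _ _ _ (nrm y / (1 - q) * (q + q)) (fun n => q ^+ n)).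
  by apply: cvg_expr; rewrite ger0_norm.
move=> n; rewrite -(subrKA (x n.+1)) (le_trans (nrmD _ _))//.
have := lx n.+1; rewrite xE.
have -> : B (x n) + y - (B l + y) = - B (l - x n).
  by rewrite (linB lB) opprB opprD addrACA subrr addr0.
rewrite nrmN exprS; have := Bq (l - x n); have := lx n.
by set u := nrm (l - x n); set v := q ^+ n; set C := _ / _; nra.
Qed.

(** [e + f = f (1 + e f^-1)], and the Neumann series inverts the second factor. *)
Lemma boundedly_surjective_perturb (f : X -> X) (M : R) (e : R[i]) :
  linear f -> 0 < M -> (forall x, nrm x <= M * nrm (f x)) ->
  (forall y, exists x, f x = y) -> cabs e * M < 1 ->
  forall y, exists x, e *: x + f x = y.
Proof.
move=> lf M0 fM fs eM y.
have [] := @boundedly_invertibleP _ _ _ f lf; first by split=> //; exists M.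
move=> g [fK gK lg _].
have gM : bounded_by M g by move=> z; rewrite (le_trans (fM _))// gK.
have lB : linear (fun x => - (e *: g x)).
  move=> a x z; rewrite lg !scalerDr !scalerA (mulrC e) opprD scalerN.
  by rewrite scalerA.
have [||x xE] := @neumann _ (cabs e * M) (g y) lB.
- by rewrite eM andbT mulr_ge0 ?cabs_ge0// ltW.
- by move=> x; rewrite nrmN nrmZ -mulrA ler_wpM2l ?cabs_ge0.
exists x; have : f x = f (- (e *: g x) + g y) by rewrite -xE.
rewrite (linD lf) (linN lf) (linZ lf) !gK => ->.
by rewrite addrA subrr add0r.
Qed.

Variables (A : X -> X) (c : R).
Hypotheses (lA : linear A) (c0 : 0 <= c) (Ac : bounded_by c A).

Let res (z : R[i]) (x : X) := z *: x - A x.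

Lemma linear_resolvent z : linear (res z).
Proof.
move=> a x y; rewrite /res lA !scalerDr scalerN !scalerA (mulrC a) opprD.
by rewrite addrACA.
Qed.

Lemma resolvent_large_bound z x : c < cabs z ->
  nrm x <= (cabs z - c)^-1 * nrm (res z x).
Proof.
move=> cz; rewrite mulrC ler_pdivlMr ?subr_gt0//.
have := nrm_dist (z *: x) (A x); rewrite -/(res z x) nrmZ.
by have := Ac x; nra.
Qed.

Lemma resolvent_large_surj z : c < cabs z -> forall y, exists x, res z x = y.
Proof.
move=> cz y; have z0 : z != 0 by rewrite -cabs_eq0 gt_eqF// (le_lt_trans c0).
have zp : 0 < cabs z by rewrite (le_lt_trans c0).
have lB : linear (fun x => z^-1 *: A x).
  by move=> a u v; rewrite lA scalerDr !scalerA mulrC.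
have [||x xE] := @neumann _ (c / cabs z) (z^-1 *: y) lB.
- by rewrite divr_ge0 ?cabs_ge0//= ltr_pdivrMr// mul1r.
- move=> x; rewrite nrmZ cabsV mulrC mulrAC.
  by rewrite ler_wpM2r ?invr_ge0 ?cabs_ge0.
exists x; rewrite /res {1}xE scalerDr !scalerA divff// !scale1r.
by rewrite addrAC subrr add0r.
Qed.

Lemma resolvent_large z : c < cabs z -> boundedly_invertible (res z).
Proof.
move=> cz; split; last exact: resolvent_large_surj.
exists (cabs z - c)^-1; first by rewrite invr_gt0 subr_gt0.
by move=> x; exact: resolvent_large_bound.
Qed.

(** Along a half-line on which the resolvent obeys a uniform a priori bound,
invertibility propagates from infinity down to the end point: each step is a
perturbation by less than the lower bound. *)
Lemma resolvent_half_line (z d : R[i]) (M : R) : 0 < M -> cabs d = 1 ->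
  (forall (s : R) x, 0 <= s -> nrm x <= M * nrm (res (z + s%:C * d) x)) ->
  boundedly_invertible (res z).
Proof.
move=> M0 d1 bnd.
suff H y : exists x, res z x = y.
  split=> //; exists M => // x; have := bnd 0 x (lexx _).
  by rewrite mul0r addr0.
pose s0 := c + cabs z + 1.
have s00 : 0 < s0 by rewrite /s0 ltr_wpDl ?addr_ge0 ?cabs_ge0.
pose N := (Num.truncn (s0 * (M * 2))).+1.
have tN : s0 / N%:R * M < 1.
  rewrite mulrAC ltr_pdivrMr ?ltr0n// mul1r.
  have : s0 * (M * 2) < N%:R by exact: truncnS_gt.
  have := mulr_gt0 s00 M0; lra.
have tN0 : 0 <= s0 / N%:R by rewrite divr_ge0// ltW.
suff {}H n : (n <= N)%N ->
    forall y, exists x, res (z + (s0 / N%:R * (N - n)%:R)%:C * d) x = y.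
  by have := H N (leqnn _) y; rewrite subnn mulr0 mul0r addr0.
elim: n => [_|n IH nN].
  rewrite subn0 divfK ?pnatr_eq0//; apply: resolvent_large_surj.
  have := cabsD (z + s0%:C * d) (- z).
  rewrite (addrC z) addrK cabsM d1 mulr1 cabs_real gtr0_norm// cabsN /s0.
  by have := cabs_ge0 z; lra.
move=> {}y; have lt0 : 0 <= s0 / N%:R * (N - n)%:R by rewrite mulr_ge0.
have [] := @boundedly_surjective_perturb _ M (- ((s0 / N%:R)%:C * d))
  (linear_resolvent _) M0 (fun x => bnd _ x lt0) (IH (ltnW nN)) _ y.
  by rewrite cabsN cabsM d1 mulr1 cabs_real ger0_norm.
move=> x; rewrite /res addrA -scalerDl => xE; exists x; rewrite -xE.
congr (_ *: _ - _); rewrite addrCA; congr (_ + _).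
rewrite -mulNr -mulrDl -rmorphN -rmorphD/=; congr (_%:C * _).
have -> : (N - n = (N - n.+1).+1)%N by rewrite subnSK.
by rewrite -[in RHS]addn1 natrD; lra.
Qed.

End neumann.

(** * Trajectories of a bounded operator *)

Section rdot.
Context {R : realType} {X : hilbertType R}.
Implicit Types x y : X.

(** The underlying real inner product; it is the polarization of [nrm]. *)
Definition rdot x y : R := complex.Re (inner x y).

Lemma rdotxx x : rdot x x = nrm x ^+ 2.
Proof. by rewrite /rdot inner_normE nrmE -rmorphXn. Qed.

Lemma rdotC x y : rdot x y = rdot y x.
Proof.
rewrite /rdot; have -> : inner x y = Num.conj (inner y x).
  by rewrite (hermC (@inner R X)) expr0 mul1r.
by case: (inner y x).
Qed.

Lemma rdotDl x y z : rdot (x + y) z = rdot x z + rdot y z.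
Proof. by rewrite /rdot linearDl raddfD. Qed.

Lemma rdotDr x y z : rdot z (x + y) = rdot z x + rdot z y.
Proof. by rewrite rdotC rdotDl !(rdotC z). Qed.

Lemma rdotZl (r : R) x y : rdot (r%:C *: x) y = r * rdot x y.
Proof.
rewrite /rdot linearZl_LR/=; case: (inner x y) => a b /=.
by rewrite mul0r subr0.
Qed.

Lemma rdotZr (r : R) x y : rdot x (r%:C *: y) = r * rdot x y.
Proof. by rewrite rdotC rdotZl rdotC. Qed.

Lemma rdotZC (z : R[i]) x : rdot (z *: x) x = complex.Re z * nrm x ^+ 2.
Proof.
rewrite /rdot linearZl_LR/= inner_normE nrmE -rmorphXn; case: z => a b /=.
by rewrite mulr0 subr0.
Qed.

Lemma rdotNl x y : rdot (- x) y = - rdot x y.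
Proof. by rewrite /rdot linearNl raddfN. Qed.

Lemma rdotNr x y : rdot x (- y) = - rdot x y.
Proof. by rewrite rdotC rdotNl rdotC. Qed.

Lemma nrmD_sqr x y :
  nrm (x + y) ^+ 2 = nrm x ^+ 2 + nrm y ^+ 2 + 2 * rdot x y.
Proof. by rewrite -!rdotxx rdotDl !rdotDr (rdotC y); ring. Qed.

(** Cauchy-Schwarz, from [0 <= | |y| x - |x| y |^2]. *)
Lemma rdot_le x y : rdot x y <= nrm x * nrm y.
Proof.
have [x0|x0] := eqVneq (nrm x) 0.
  by rewrite (nrm0_eq0 x0) /rdot linear0l nrm0 mul0r.
have [y0|y0] := eqVneq (nrm y) 0.
  by rewrite (nrm0_eq0 y0) rdotC /rdot linear0l nrm0 mulr0.
have xy0 : 0 < nrm x * nrm y by 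
  rewrite mulr_gt0// lt_neqAle nrm_ge0 eq_sym ?x0 ?y0.
rewrite -(ler_pM2l xy0).
have := sqr_ge0 (nrm ((nrm y)%:C *: x + - ((nrm x)%:C *: y))).
rewrite nrmD_sqr nrmN !nrmZ !cabs_real !ger0_norm ?nrm_ge0//.
by rewrite rdotNr rdotZl rdotZr; nra.
Qed.

Lemma rdot_norm_le x y : `|rdot x y| <= nrm x * nrm y.
Proof.
by rewrite ler_norml rdot_le andbT lerNl -rdotNl -(nrmN x) rdot_le.
Qed.

End rdot.

Section gronwall.
Context {R : realType}.

Lemma gronwall (phi dphi : R -> R) (k T : R) : 0 <= T ->
  {within `[0, +oo[, continuous phi} ->
  (forall t : R, 0 < t < T -> is_derive t 1 phi (dphi t)) ->
  (forall t : R, 0 < t < T -> dphi t <= k * phi t) ->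
  phi T <= phi 0 * expR (k * T).
Proof.
move=> T0 cphi dphiE kphi.
pose psi s := phi s * expR (- k * s).
have dpsi (s : R) : 0 < s < T ->
    is_derive s 1 psi (phi s *: (expR (- k * s) *: - k) +
                       expR (- k * s) *: dphi s).
  move=> sT; have ds := dphiE _ sT.
  have de : is_derive s 1 (fun s => expR (- k * s)) (expR (- k * s) *: - k).
    have dk : is_derive s 1 ( *%R (- k)) (- k).
      have := is_deriveZ (- k) (is_derive_id s 1).
      by rewrite /GRing.scale/= mulr1.
    exact: is_derive1_comp.
  exact: is_deriveM.
have cpsi : {within `[0, T], continuous psi}.
  have : {within `[0, +oo[, continuous psi}.
    move=> s; apply: cvgM; first exact: cphi.
    have ce : continuous (fun s : R => expR (- k * s)).
      move=> r; apply: continuous_comp; last exact: continuous_expR.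
      exact: mulrl_continuous.
    exact: (continuous_subspaceT ce).
  apply: continuous_subspaceW => s/=; rewrite !in_itv/= => /andP[->//].
have : psi T <= psi 0.
  apply: (@ler0_derive1_le_cc _ psi 0 T) => //.
  - by move=> s; rewrite in_itv/= => sT; have [] := dpsi _ sT.
  - move=> s; rewrite in_itv/= => sT; have [_ ] := dpsi _ sT.
    rewrite derive1E => ->; have := kphi _ sT; have := expR_gt0 (- k * s).
    by rewrite /GRing.scale/=; nra.
  - by rewrite in_itv/= lexx T0.
  - by rewrite in_itv/= T0 lexx.
rewrite /psi mulr0 expR0 mulr1 mulNr expRN => h.
by rewrite -ler_pdivrMr ?expR_gt0.
Qed.

Lemma mean_value_le (phi dphi : R -> R) (M T : R) : 0 <= T ->
  {within `[0, +oo[, continuous phi} ->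
  (forall t : R, 0 < t < T -> is_derive t 1 phi (dphi t)) ->
  (forall t : R, 0 < t < T -> dphi t <= M) ->
  phi T <= phi 0 + M * T.
Proof.
move=> T0 cphi dphiE dM.
have := @gronwall (fun s => phi s - M * s) (fun s => dphi s - M) 0 T T0.
rewrite mul0r expR0 mulr1 mulr0 subr0 -lerBlDr; apply.
- move=> s; apply: cvgB; first exact: cphi.
  have cM : continuous (fun s : R => M * s) by exact: mulrl_continuous.
  exact: (continuous_subspaceT cM).
- move=> s sT; have ds := dphiE _ sT.
  have dk : is_derive s 1 ( *%R M) M.
    by have := is_deriveZ M (is_derive_id s 1); rewrite /GRing.scale/= mulr1.
  exact: is_deriveB.
- by move=> s sT; rewrite mul0r subr_le0 dM.
Qed.

End gronwall.

Section trajectory.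
Context {R : realType} {X : hilbertType R}.
Implicit Types (u w : R -> X) (t : R).

Lemma time_derivativeP u t v : is_time_derivative u t v <->
  forall e : R, 0 < e -> \forall h \near (0 : R)^',
    nrm (v - (h^-1)%:C *: (u (t + h) - u t)) < e.
Proof. exact: cvg_nrmP. Qed.

Lemma time_derivative_comp (Y : hilbertType R) (B : X -> Y) (c : R) u t v :
  linear B -> 0 < c -> bounded_by c B ->
  is_time_derivative u t v -> is_time_derivative (B \o u) t (B v).
Proof.
move=> lB c0 Bc /time_derivativeP uv; apply/cvg_nrmP => e e0.
have ec : 0 < e / c by rewrite divr_gt0.
apply: filterS (uv _ ec) => h; rewrite ltr_pdivlMr// mulrC => vh.
by rewrite -(linB lB) -(linZ lB) -(linB lB) (le_lt_trans (Bc _)).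
Qed.

Lemma time_derivative_lin (a : R[i]) u w t v z :
  is_time_derivative u t v -> is_time_derivative w t z ->
  is_time_derivative (fun s => a *: u s + w s) t (a *: v + z).
Proof.
move=> uv wz; rewrite /is_time_derivative.
have -> : (fun h : R => (h^-1)%:C *: (a *: u (t + h) + w (t + h)
                                        - (a *: u t + w t))) =
  (fun h : R => a *: ((h^-1)%:C *: (u (t + h) - u t))
                + (h^-1)%:C *: (w (t + h) - w t)).
  apply/funext => h; rewrite opprD addrACA -scalerBr scalerDr !scalerA.
  by rewrite (mulrC a).
by apply: cvgD => //; exact: cvgZr.
Qed.

Lemma continuous_nrm : continuous (@nrm R X).
Proof.
move=> x; apply/cvgrPdist_lt => e e0.
have /cvg_nrmP/(_ _ e0) : id @ x --> x by exact: cvg_id.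
apply: filterS => y; apply: le_lt_trans.
by rewrite ler_norml nrm_dist andbT lerNl opprB nrm_distC nrm_dist.
Qed.

(** If [q] is a difference quotient of [u] with step [h], then that of [|u|^2] is
[2 Re <q, u t> + h |q|^2]. *)
Lemma energy_derivative u t v : is_time_derivative u t v ->
  is_derive t (1 : R) (fun s => nrm (u s) ^+ 2) (2 * rdot v (u t)).
Proof.
move=> uv.
have H : (fun h : R => h^-1 *: (nrm (u (h *: 1 + t)) ^+ 2 - nrm (u t) ^+ 2))
    @ (0 : R)^' --> 2 * rdot v (u t).
  apply/cvgrPdist_lt => e e0.
  pose a := nrm (u t); pose b := nrm v.
  have [a0 b0] : 0 <= a /\ 0 <= b by rewrite !nrm_ge0.
  pose d := Num.min 1 (e / (4 * (a + 1))).
  have d0 : 0 < d by rewrite lt_min ltr01/= divr_gt0// mulr_gt0// ltr_wpDl.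
  pose k := e / (2 * (b + 1) ^+ 2).
  have k0 : 0 < k by rewrite divr_gt0// mulr_gt0// exprn_gt0// ltr_wpDl.
  have uvd := (time_derivativeP _ _ _).1 uv _ d0.
  near=> h.
  have h0 : h != 0 by near: h; exact: nbhs_dnbhs_neq.
  have hk : `|h| < k by near: h; exact: dnbhs0_lt.
  have : nrm (v - (h^-1)%:C *: (u (t + h) - u t)) < d by near: h; exact: uvd.
  set q := (h^-1)%:C *: (u (t + h) - u t) => vq.
  have uE : u (h *: 1 + t) = u t + h%:C *: q.
    rewrite /q scalerA -rmorphM/= divff// scale1r addrCA subrr addr0.
    by rewrite /GRing.scale/= mulr1 addrC.
  rewrite uE nrmD_sqr nrmZ cabs_real exprMn real_normK ?num_real//.
  rewrite (rdotC (u t)) rdotZl -/a {1}/GRing.scale/=.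
  have -> : h^-1 *
      (a ^+ 2 + h ^+ 2 * nrm q ^+ 2 + 2 * (h * rdot q (u t)) - a ^+ 2)
      = h * nrm q ^+ 2 + 2 * rdot q (u t) by field.
  have -> : 2 * rdot v (u t) - (h * nrm q ^+ 2 + 2 * rdot q (u t)) =
     2 * rdot (v - q) (u t) - h * nrm q ^+ 2.
    by rewrite rdotDl rdotNl; ring.
  rewrite (le_lt_trans (ler_normB _ _))//.
  rewrite [`|2 * _|]normrM normr_nat [`|h * _|]normrM.
  rewrite (ger0_norm (sqr_ge0 (nrm q))).
  have qb : nrm q ^+ 2 <= (b + 1) ^+ 2.
    rewrite ler_pXn2r ?nnegrE ?nrm_ge0 ?addr_ge0//.
    have := nrm_dist q v; rewrite nrm_distC.
    by move: vq; rewrite lt_min => /andP[? _]; rewrite -/b; lra.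
  have r1 : 2 * `|rdot (v - q) (u t)| <= e / 2.
    have := rdot_norm_le (v - q) (u t); rewrite -/a.
    move: vq; rewrite lt_min => /andP[_]; rewrite ltr_pdivlMr; last first.
      by rewrite mulr_gt0// ltr_wpDl.
    have := nrm_ge0 (v - q); nra.
  have r2 : `|h| * nrm q ^+ 2 < e / 2.
    apply: (@le_lt_trans _ _ (`|h| * (b + 1) ^+ 2)); first by rewrite ler_wpM2l.
    move: hk; rewrite /k ltr_pdivlMr; first lra.
    by rewrite mulr_gt0// exprn_gt0// ltr_wpDl.
  lra.
by apply: DeriveDef; [exact: cvgP H | exact: (cvg_lim (@Rhausdorff R) H)].
Unshelve. all: by end_near. Qed.

(** Trajectories are specified by the initial value problem itself, in the form
used for strong solutions of the pencil, so that the two can be exchanged. *)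
Definition flow (A : X -> X) (x : X) (u : R -> X) : Prop :=
  [/\ {within `[0, +oo[, continuous u}, u 0 = x &
      forall t : R, 0 < t -> is_time_derivative u t (A (u t))].

Lemma bounded_continuous (B : X -> X) (c : R) : linear B -> 0 < c ->
  bounded_by c B -> continuous B.
Proof.
move=> lB c0 Bc x; apply/cvg_nrmP => e e0.
have ec : 0 < e / c by rewrite divr_gt0.
have /cvg_nrmP/(_ _ ec) : id @ x --> x by exact: cvg_id.
apply: filterS => y; rewrite ltr_pdivlMr// mulrC -(linB lB).
exact: le_lt_trans.
Qed.

Lemma flow_comp (A B : X -> X) (c : R) x u : linear B -> 0 < c ->
  bounded_by c B -> (forall y, B (A y) = A (B y)) ->
  flow A x u -> flow A (B x) (B \o u).
Proof.
move=> lB c0 Bc BA [cu u0 du]; split=> [|/=|t t0]; last 2 first.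
- by rewrite u0.
- by rewrite /= -BA; apply: time_derivative_comp lB c0 Bc _; exact: du.
move=> s; apply: continuous_comp (cu s) _.
exact: (bounded_continuous lB c0 Bc).
Qed.

Lemma flow_lin (A : X -> X) (a : R[i]) x y u w : linear A ->
  flow A x u -> flow A y w -> flow A (a *: x + y) (fun s => a *: u s + w s).
Proof.
move=> lA [cu u0 du] [cw w0 dw]; split=> [s|/=|t t0]; last 2 first.
- by rewrite u0 w0.
- by rewrite lA; apply: time_derivative_lin; [exact: du|exact: dw].
by apply: cvgD; [apply: cvgZr; exact: cu | exact: cw].
Qed.

Lemma flow_energy_continuous (A : X -> X) x u : flow A x u ->
  {within `[0, +oo[, continuous (fun s => nrm (u s) ^+ 2)}.
Proof.
move=> [cu _ _] s.
apply: (@cvg_comp _ _ _ (@nrm R X \o u) (fun r => r ^+ 2) _ (nbhs (nrm (u s)))).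
  by apply: continuous_comp (cu s) _; exact: continuous_nrm.
exact: exprn_continuous.
Qed.

Section bounded_generator.
Variables (A : X -> X) (c : R).
Hypotheses (lA : linear A) (c0 : 0 <= c) (Ac : bounded_by c A).

(** Gronwall, from [2 Re <A u, u> <= |A u|^2 + |u|^2 <= (c^2 + 1) |u|^2]. *)
Lemma flow_growth x u t : flow A x u -> 0 <= t ->
  nrm (u t) ^+ 2 <= nrm x ^+ 2 * expR ((c ^+ 2 + 1) * t).
Proof.
move=> ux t0; have [cu u0 du] := ux; rewrite -u0.
apply: (@gronwall _ (fun s => nrm (u s) ^+ 2)
  (fun s => 2 * rdot (A (u s)) (u s))) => //.
- exact: flow_energy_continuous ux.
- by move=> s /andP[s0 _]; apply: energy_derivative; exact: du.
- move=> s _; have := rdot_le (A (u s)) (u s); have := Ac (u s).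
  have := nrm_ge0 (u s); have := nrm_ge0 (A (u s)).
  set a := nrm (A _); set b := nrm (u s) => a0 b0 abc abr.
  have : a ^+ 2 <= c ^+ 2 * b ^+ 2.
    by rewrite -exprMn ler_pXn2r ?nnegrE ?mulr_ge0.
  have := sqr_ge0 (a - b); nra.
Qed.

Lemma flow_unique x u w t : flow A x u -> flow A x w -> 0 <= t -> u t = w t.
Proof.
move=> ux wx t0.
have := flow_growth (flow_lin (-1) lA ux wx) t0.
rewrite !scaleN1r addNr nrm0 expr0n/= mul0r.
rewrite exprn_even_le0//= addrC => /eqP/nrm0_eq0/eqP.
by rewrite subr_eq0 => /eqP.
Qed.

End bounded_generator.
End trajectory.

(** * Existence of trajectories *)

Section exponential_terms.
Context {R : realType}.
Implicit Types (s t h : R).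

Lemma exp_coeff0 t : exp_coeff t 0 = 1.
Proof. by rewrite /exp_coeff/= expr0 divr1. Qed.

Lemma exp_coeff1 t : exp_coeff t 1 = t.
Proof. by rewrite /exp_coeff/= expr1 divr1. Qed.

Lemma exp_coeffSM t n : n.+1%:R * exp_coeff t n.+1 = t * exp_coeff t n.
Proof.
rewrite /exp_coeff/= factS natrM exprS; field.
by rewrite pnatr_eq0 -lt0n fact_gt0 addrC natr1 pnatr_eq0.
Qed.

(** Second-order Taylor remainder of [t ^+ n / n!], bounded by a term of the
exponential series so that the remainders can be summed. *)
Lemma exp_coeff_taylor t h n :
  `|exp_coeff (t + h) n.+2 - exp_coeff t n.+2 - h * exp_coeff t n.+1| <=
  h ^+ 2 * exp_coeff (`|t| + `|h|) n.
Proof.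
set s := `|t| + `|h|.
have s0 : 0 <= s by rewrite addr_ge0.
elim: n => [|n IH].
  have -> :
      exp_coeff (t + h) 2 - exp_coeff t 2 - h * exp_coeff t 1 = h ^+ 2 / 2.
    by rewrite /exp_coeff/= (_ : 2`! = 2%N)// (_ : 1`! = 1%N)//; field.
  rewrite exp_coeff0 ger0_norm ?divr_ge0 ?sqr_ge0// mulr1.
  by have := sqr_ge0 h; lra.
have pn : 0 < n.+3%:R :> R by rewrite ltr0n.
rewrite -(ler_pM2l pn) -{1}(ger0_norm (ltW pn)) -normrM !mulrBr exp_coeffSM.
rewrite exp_coeffSM (mulrCA _ h).
have -> : n.+3%:R * exp_coeff t n.+2 = exp_coeff t n.+2 + t * exp_coeff t n.+1.
  by rewrite -exp_coeffSM -(natr1 n.+2); ring.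
have -> : (t + h) * exp_coeff (t + h) n.+2 - t * exp_coeff t n.+2 -
    h * (exp_coeff t n.+2 + t * exp_coeff t n.+1) =
  (t + h) * (exp_coeff (t + h) n.+2 - exp_coeff t n.+2 - h * exp_coeff t n.+1)
  + h ^+ 2 * exp_coeff t n.+1 by ring.
have th : `|t + h| <= s by exact: ler_normD.
have ps : `|exp_coeff t n.+1| <= exp_coeff s n.+1.
  rewrite /exp_coeff/= normrM normrX normfV normr_nat ler_wpM2r ?invr_ge0//.
  by rewrite lerXn2r ?nnegrE// lerDl.
have psS := exp_coeffSM s n.
have ps0 : 0 <= exp_coeff s n by exact: exp_coeff_ge0.
have ps1 : 0 <= exp_coeff s n.+1 by exact: exp_coeff_ge0.
rewrite (le_trans (ler_normD _ _))// normrM [`|h ^+ 2 * _|]normrM.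
rewrite (ger0_norm (sqr_ge0 h)).
apply: (@le_trans _ _
  (s * (h ^+ 2 * exp_coeff s n) + h ^+ 2 * exp_coeff s n.+1)).
  by apply: lerD; [exact: ler_pM | rewrite ler_wpM2l// sqr_ge0].
rewrite (mulrCA s) -psS -(natr1 n.+2) -(natr1 n.+1).
by have := mulr_ge0 (sqr_ge0 h) ps1; lra.
Qed.

Lemma series_exp_coeff_le (x : R) n :
  0 <= x -> series (exp_coeff x) n <= expR x.
Proof.
move=> x0; apply: nondecreasing_cvgn_le (is_cvg_series_exp_coeff x) n.
by apply/nondecreasing_seqP => n; rewrite seriesSr lerDl exp_coeff_ge0.
Qed.

Lemma cvg_exp_tail (x C : R) :
  C * (expR x - series (exp_coeff x) n) @[n --> \oo] --> 0.
Proof.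
rewrite -[X in _ --> X](mulr0 C) -[X in C * X](subrr (expR x)).
apply: cvgM; first exact: cvg_cst.
by apply: cvgB; [exact: cvg_cst | exact: is_cvg_series_exp_coeff].
Qed.

End exponential_terms.

Section existence.
Context {R : realType} {X : hilbertType R}.
Variables (A : X -> X) (c : R).
Hypotheses (lA : linear A) (c0 : 0 <= c) (Ac : bounded_by c A).
Variable x : X.

Let S (t : R) := series (fun n => (exp_coeff t n)%:C *: iter n A x).

Let SS t n : S t n.+1 = S t n + (exp_coeff t n)%:C *: iter n A x.
Proof. exact: seriesSr. Qed.

Let S0 t : S t 0 = 0.
Proof. by rewrite /S /series/= big_geq. Qed.

Let tail (t : R) n :=
  nrm x * (expR (c * `|t|) - series (exp_coeff (c * `|t|)) n).

Let S_cvg t : exists l, forall n, nrm (l - S t n) <= tail t n.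
Proof.
apply: nrm_telescope_cvg; first exact: cvg_exp_tail.
move=> n; rewrite SS addrC addKr nrmZ cabs_real /tail.
have -> : forall y, nrm x * (y - series (exp_coeff (c * `|t|)) n) -
    nrm x * (y - series (exp_coeff (c * `|t|)) n.+1) =
    nrm x * exp_coeff (c * `|t|) n by move=> y; rewrite seriesSr; ring.
have -> : exp_coeff (c * `|t|) n = c ^+ n * `|exp_coeff t n|.
  by rewrite /exp_coeff/= normrM normfV normr_nat normrX exprMn mulrA.
rewrite mulrC mulrA ler_wpM2r// [X in _ <= X]mulrC.
exact: bounded_by_iter.
Qed.

Let partial_sum_taylor t h n :
  nrm (S (t + h) n.+2 - S t n.+2 - h%:C *: A (S t n.+1)) <=
  h ^+ 2 * (c ^+ 2 * nrm x) * series (exp_coeff (c * (`|t| + `|h|))) n.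
Proof.
elim: n => [|n IH].
  rewrite !SS !S0 !exp_coeff0 !exp_coeff1 !add0r !scale1r/=.
  rewrite opprD addrACA subrr add0r -scalerBl -rmorphB/= (addrC t) addrK.
  by rewrite addrN nrm0 /series/= big_geq// mulr0.
rewrite (SS (t + h)) (SS t n.+2) (congr1 A (SS t n.+1)).
rewrite (linD lA) (linZ lA) -iterS.
have addr6 (a b d p q r : X) :
    (a + p) - (b + q) - (d + r) = (a - b - d) + (p - q - r).
  by rewrite !opprD [X in X + _]addrACA [LHS]addrACA.
rewrite scalerDr addr6 scalerA -!scalerBl.
rewrite -rmorphM -!rmorphB/= (le_trans (nrmD _ _))//.
rewrite [series (exp_coeff _) n.+1]seriesSr mulrDr lerD//.
rewrite nrmZ cabs_real.
apply: (@le_trans _ _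
  (h ^+ 2 * exp_coeff (`|t| + `|h|) n * (c ^+ n.+2 * nrm x))).
  apply: ler_pM; rewrite ?nrm_ge0//; first exact: exp_coeff_taylor.
  exact: (bounded_by_iter n.+2 c0 Ac x).
by rewrite /exp_coeff/= exprMn -[n.+2]addn2 exprD; apply: eq_ler; ring.
Qed.

(** The exponential series: the Taylor estimate of its partial sums is uniform in
the number of terms, and so passes to the limit. *)
Theorem flow_exists : exists u, flow A x u.
Proof.
have /choice[u uS] := S_cvg; exists u.
pose K (t : R) := c ^+ 2 * nrm x * expR (c * (`|t| + 1)).
have K0 t : 0 <= K t by rewrite !mulr_ge0 ?sqr_ge0 ?nrm_ge0 ?expR_ge0.
have taylor (t h : R) : `|h| <= 1 ->
    nrm (u (t + h) - u t - h%:C *: A (u t)) <= h ^+ 2 * K t.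
  move=> h1; rewrite -subr_le0.
  pose b (n : nat) := tail (t + h) n.+2 + tail t n.+2 + `|h| * c * tail t n.+1.
  apply: (@le0_squeeze _ _ b).
    have tl s k : tail s (n + k)%N @[n --> \oo] --> 0.
      by have := cvg_exp_tail (c * `|s|) (nrm x); rewrite -(cvg_shiftn k).
    rewrite -[X in _ --> X]addr0 -[X in _ --> X + _]addr0.
    rewrite -[X in _ --> _ + X](mulr0 (`|h| * c)).
    apply: cvgD; last first.
      apply: cvgM; first exact: cvg_cst.
      by have := tl t 1%N; under eq_fun do rewrite addn1.
    by apply: cvgD; [have := tl (t + h) 2%N | have := tl t 2%N];
      under eq_fun do rewrite addn2.
  move=> n; rewrite lerBlDr.
  have -> : u (t + h) - u t - h%:C *: A (u t) =
      (u (t + h) - S (t + h) n.+2) - (u t - S t n.+2)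
      - h%:C *: A (u t - S t n.+1)
      + (S (t + h) n.+2 - S t n.+2 - h%:C *: A (S t n.+1)).
    rewrite (linB lA) scalerBr (subrACA (u (t + h)) _ (u t)).
    by rewrite (subrACA (u (t + h) - u t) _ (h%:C *: A (u t))) subrK.
  rewrite (le_trans (nrmD _ _))// lerD//.
    rewrite (le_trans (nrmB _ _))// lerD//.
      by rewrite (le_trans (nrmB _ _))// lerD.
    rewrite nrmZ cabs_real -mulrA ler_wpM2l// (le_trans (Ac _))//.
    by rewrite ler_wpM2l.
  rewrite (le_trans (partial_sum_taylor _ _ _))// -mulrA ler_wpM2l ?sqr_ge0//.
  rewrite /K ler_wpM2l// ?mulr_ge0 ?sqr_ge0 ?nrm_ge0//.
  rewrite (le_trans (series_exp_coeff_le _ _)) ?mulr_ge0 ?addr_ge0//.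
  by rewrite ler_expR ler_wpM2l// lerD2l.
have du t : is_time_derivative u t (A (u t)).
  apply/time_derivativeP => e e0.
  have eK : 0 < e / (K t + 1) by rewrite divr_gt0// ltr_wpDl.
  near=> h.
  have h0 : h != 0 by near: h; exact: nbhs_dnbhs_neq.
  have hk : `|h| < e / (K t + 1) by near: h; exact: dnbhs0_lt.
  have h1 : `|h| <= 1 by near: h; exact: dnbhs0_le.
  have -> : A (u t) - (h^-1)%:C *: (u (t + h) - u t) =
      - ((h^-1)%:C *: (u (t + h) - u t - h%:C *: A (u t))).
    by rewrite [in RHS]scalerBr scalerA -rmorphM/= mulVf// scale1r opprB.
  rewrite nrmN nrmZ cabs_real normfV mulrC ltr_pdivrMr ?normr_gt0//.
  rewrite (le_lt_trans (taylor _ _ h1))// -[h ^+ 2]real_normK ?num_real//.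
  rewrite expr2 -mulrA [X in _ < X]mulrC ltr_pM2l ?normr_gt0//.
  move: hk; rewrite ltr_pdivlMr ?ltr_wpDl//; apply: le_lt_trans.
  by rewrite ler_wpM2l// lerDl.
split=> //.
- apply: continuous_subspaceT => t; apply/cvg_nrmP => e e0.
  pose L := nrm (A (u t)) + K t + 1.
  have L0 : 0 < L by rewrite ltr_wpDl ?addr_ge0 ?nrm_ge0.
  have eL : 0 < Num.min 1 (e / L) by rewrite lt_min ltr01 divr_gt0.
  have /cvgrPdist_lt/(_ _ eL) : id @ t --> t by exact: cvg_id.
  apply: filterS => s /=; rewrite lt_min => /andP[st1]; rewrite ltr_pdivlMr//.
  apply: le_lt_trans; rewrite distrC in st1 *.
  have := taylor t (s - t) (ltW st1); rewrite [t + _]addrC subrK => H.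
  rewrite nrm_distC -(subrK ((s - t)%:C *: A (u t)) (u s - u t)).
  rewrite (le_trans (nrmD _ _))// nrmZ cabs_real.
  have : (s - t) ^+ 2 <= `|s - t|.
    by rewrite -real_normK ?num_real// expr2 ler_piMr// ltW.
  move=> st2; have := ler_wpM2r (K0 t) st2.
  by rewrite /L; have := normr_ge0 (s - t); move: H; lra.
- have := uS 0 1%N; rewrite /tail normr0 mulr0 expR0 series_exp_coeff0 subrr.
  rewrite mulr0 SS S0 add0r exp_coeff0 scale1r => /nrm_le0_eq0/eqP.
  by rewrite subr_eq0 => /eqP.
Unshelve. all: by end_near. Qed.

End existence.

(** * Resolvent estimates from trajectories *)

Section resolvent_bounds.
Context {R : realType} {X : hilbertType R}.
Variables (A : X -> X) (c : R).
Hypotheses (lA : linear A) (c0 : 0 < c) (Ac : bounded_by c A).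

Let k := c ^+ 2 + 1.
Let k0 : 0 <= k. Proof. by rewrite addr_ge0 ?sqr_ge0. Qed.

(** Along a trajectory [A u] solves the same equation, so [A u - z u] is the
trajectory of the defect [A x - z x]; the energy of [u] therefore changes at
the rate [2 Re z] up to the size of the defect. *)
Lemma flow_energy_rate (z : R[i]) x u (T : R) : flow A x u -> 0 <= T ->
  exists dphi : R -> R, forall t, 0 < t < T ->
    is_derive t (1 : R) (fun s => nrm (u s) ^+ 2) (dphi t) /\
    `|dphi t - 2 * complex.Re z * nrm (u t) ^+ 2| <=
      2 * expR (k * T) * (nrm x * nrm (z *: x - A x)).
Proof.
move=> ux T0; have [cu u0 du] := ux.
pose y := A x - z *: x.
have [w wy] := flow_exists lA (ltW c0) Ac y.
have Au t : 0 <= t -> A (u t) = z *: u t + w t.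
  apply: (@flow_unique _ _ A c lA (ltW c0) Ac (A x) (A \o u)
    (fun t => z *: u t + w t)).
    exact: (flow_comp lA c0 Ac (fun _ => erefl) ux).
  have -> : A x = z *: x + y by rewrite /y addrC subrK.
  exact: flow_lin.
exists (fun t => 2 * rdot (A (u t)) (u t)) => t /andP[t0 tT]; split.
  by apply: energy_derivative; exact: du.
rewrite /= (Au _ (ltW t0)) rdotDl rdotZC.
have -> : 2 * (complex.Re z * nrm (u t) ^+ 2 + rdot (w t) (u t)) -
  2 * complex.Re z * nrm (u t) ^+ 2 = 2 * rdot (w t) (u t) by ring.
rewrite normrM normr_nat -[leRHS]mulrA ler_wpM2l//.
rewrite (le_trans (rdot_norm_le _ _))//.
have yE : nrm (z *: x - A x) = nrm y by rewrite nrm_distC.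
rewrite yE -(ler_pXn2r (_ : (0 < 2)%N))//
  ?nnegrE ?mulr_ge0 ?nrm_ge0 ?expR_ge0//.
have ex : expR (k * t) <= expR (k * T) by rewrite ler_expR ler_wpM2l// ltW.
have up (v : X) : nrm v ^+ 2 * expR (k * t) <= nrm v ^+ 2 * expR (k * T).
  by rewrite ler_wpM2l// sqr_ge0.
have H1 := le_trans (flow_growth (ltW c0) Ac ux (ltW t0)) (up x).
have H2 := le_trans (flow_growth (ltW c0) Ac wy (ltW t0)) (up y).
rewrite !exprMn (le_trans (ler_pM (sqr_ge0 _) (sqr_ge0 _) H2 H1))//.
by apply: eq_ler; ring.
Qed.

(** If [x] were nearly an eigenvector for some [Re z >= 0], then [|u|^2] would be
nearly nondecreasing along the trajectory of [x], which therefore could not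
halve in norm. *)
Lemma resolvent_bound_decay (z : R[i]) x u (T : R) : flow A x u -> 0 <= T ->
  0 <= complex.Re z -> nrm (u T) <= 2^-1 * nrm x ->
  nrm x <= 4 * expR (k * T) * T * nrm (z *: x - A x).
Proof.
move=> ux T0 z0 uT; have [cu u0 du] := ux.
have [dphi dphiP] := flow_energy_rate z ux T0.
have : - nrm (u T) ^+ 2 <= - nrm (u 0) ^+ 2 +
    2 * expR (k * T) * (nrm x * nrm (z *: x - A x)) * T.
  apply: (@mean_value_le _ (fun s => - nrm (u s) ^+ 2)
    (fun t => - dphi t)) => //.
  - by move=> s; apply: cvgN; exact: (flow_energy_continuous ux).
  - by move=> t tT; have [? _] := dphiP _ tT; exact: is_deriveN.
  - move=> t tT; have [_] := dphiP _ tT; rewrite ler_norml => /andP[+ _].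
    have : 0 <= 2 * complex.Re z * nrm (u t) ^+ 2.
      by rewrite mulr_ge0 ?sqr_ge0// mulr_ge0.
    lra.
rewrite u0; have [->|x0] := eqVneq (nrm x) 0.
  by rewrite !mulr_ge0 ?expR_ge0 ?nrm_ge0.
have xp : 0 < nrm x by rewrite lt_neqAle eq_sym x0 nrm_ge0.
rewrite -[nrm x <= _](ler_pM2l xp).
have : nrm (u T) ^+ 2 <= 4^-1 * nrm x ^+ 2.
  have := nrm_ge0 (u T); move: uT; rewrite -subr_ge0 => h1 h2.
  have : 0 <= (2^-1 * nrm x - nrm (u T)) * (2^-1 * nrm x + nrm (u T)).
    by rewrite mulr_ge0// addr_ge0// mulr_ge0// ltW.
  by rewrite !expr2; lra.
set E := expR _; set y := nrm (_ - _).
have : 0 <= E * T * y * nrm x by rewrite !mulr_ge0 ?expR_ge0 ?nrm_ge0.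
by rewrite !expr2; lra.
Qed.

Lemma resolvent_bound_growth (z : R[i]) x u (T : R) : flow A x u -> 0 <= T ->
  complex.Re z <= 0 -> 2 * nrm x <= nrm (u T) ->
  nrm x <= 4 * expR (k * T) * T * nrm (z *: x - A x).
Proof.
move=> ux T0 z0 uT; have [cu u0 du] := ux.
have [dphi dphiP] := flow_energy_rate z ux T0.
have : nrm (u T) ^+ 2 <= nrm (u 0) ^+ 2 +
    2 * expR (k * T) * (nrm x * nrm (z *: x - A x)) * T.
  apply: (@mean_value_le _ (fun s => nrm (u s) ^+ 2) dphi) => //.
  - exact: (flow_energy_continuous ux).
  - by move=> t /dphiP[].
  - move=> t tT; have [_] := dphiP _ tT; rewrite ler_norml => /andP[_].
    have : 2 * complex.Re z * nrm (u t) ^+ 2 <= 0.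
      by rewrite mulr_le0_ge0 ?sqr_ge0//; lra.
    lra.
rewrite u0; have [->|x0] := eqVneq (nrm x) 0.
  by rewrite !mulr_ge0 ?expR_ge0 ?nrm_ge0.
have xp : 0 < nrm x by rewrite lt_neqAle eq_sym x0 nrm_ge0.
rewrite -[nrm x <= _](ler_pM2l xp).
have : 4 * nrm x ^+ 2 <= nrm (u T) ^+ 2.
  have := nrm_ge0 (u T); move: uT; rewrite -subr_ge0 => h1 h2.
  have : 0 <= (nrm (u T) - 2 * nrm x) * (nrm (u T) + 2 * nrm x).
    by rewrite mulr_ge0// addr_ge0// mulr_ge0// ltW.
  by rewrite !expr2; lra.
set E := expR _; set y := nrm (_ - _).
have : 0 <= E * T * y * nrm x by rewrite !mulr_ge0 ?expR_ge0 ?nrm_ge0.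
by rewrite !expr2; lra.
Qed.

End resolvent_bounds.

(** * From a dichotomy to the resolvent *)

Section dichotomy_to_resolvent.
Context {R : realType} {X : hilbertType R}.
Variables (A : X -> X) (c : R).
Hypotheses (lA : linear A) (c0 : 0 < c) (Ac : bounded_by c A).

Definition flow_invariant (S : set X) := forall x u, S x -> flow A x u ->
  forall t : R, 0 < t -> S (u t).

Lemma flow_near0 x u (e : R) : flow A x u -> 0 < e ->
  exists2 t : R, 0 < t & nrm (x - u t) < e.
Proof.
move=> [/continuous_within_itvcyP[_ ux] u0 _] e0.
have /cvg_nrmP/(_ _ e0) ue := ux; rewrite u0 in ue.
near (0 : R)^'+ => t; exists t; first by near: t; exact: nbhs_right_gt.
by near: t; exact: ue.
Unshelve. all: by end_near. Qed.

(** [A x] is the limit at time [0] of the derivatives of the trajectory, and these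
are limits of difference quotients in [S]. *)
Lemma flow_invariant_generator (S : set X) : closed S ->
  (forall (a : R[i]) x y, S x -> S y -> S (a *: x + y)) ->
  flow_invariant S -> forall x, S x -> S (A x).
Proof.
move=> clS linS invS x Sx; have [u ux] := flow_exists lA (ltW c0) Ac x.
have Sy y z : S y -> S z -> S (y - z).
  by move=> ? ?; rewrite addrC -scaleN1r; exact: linS.
have S0 : S 0 by have := Sy _ _ Sx Sx; rewrite subrr.
have SAu t : 0 < t -> S (A (u t)).
  move=> t0; apply: (nrm_closed clS) => e e0; have [_ _ du] := ux.
  have /time_derivativeP/(_ _ e0) ue := du _ t0.
  near (0 : R)^' => h.
  exists ((h^-1)%:C *: (u (t + h) - u t)); last by near: h; exact: ue.
  rewrite -[_ *: _]addr0; apply: linS => //; apply: Sy; last exact: invS ux _ _.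
  apply: (invS _ _ Sx ux); rewrite -ltrBlDl sub0r.
  have : `|h| < t by near: h; exact: dnbhs0_lt.
  by rewrite ltr_norml => /andP[].
apply: (nrm_closed clS) => e e0.
have Aux := flow_comp lA c0 Ac (fun _ => erefl) ux.
by have [t t0 te] := flow_near0 Aux e0; exists (A (u t)) => //; exact: SAu.
Unshelve. all: by end_near. Qed.

Variables (S T : set X) (rho C1 C2 : R).
Hypotheses (clS : closed S) (clT : closed T).
Hypotheses (linS : forall (a : R[i]) x y, S x -> S y -> S (a *: x + y))
           (linT : forall (a : R[i]) x y, T x -> T y -> T (a *: x + y)).
Hypotheses (invS : flow_invariant S) (invT : flow_invariant T).
Hypothesis (STX : forall x, exists s r, [/\ S s, T r & x = s + r]).
Hypotheses (rho0 : 0 < rho) (C10 : 0 < C1) (C20 : 0 < C2).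
Hypothesis decay : forall x u (t : R), flow A x u -> 0 <= t -> S x ->
  nrm (u t) <= C1 * expR (- rho * t) * nrm x.
Hypothesis growth : forall x u (t : R), flow A x u -> 0 <= t -> T x ->
  C2 * expR (rho * t) * nrm x <= nrm (u t).

Let k := c ^+ 2 + 1.

Lemma dichotomy_time : exists2 t : R, 0 <= t &
  (forall x u, flow A x u -> S x -> nrm (u t) <= 2^-1 * nrm x) /\
  (forall x u, flow A x u -> T x -> 2 * nrm x <= nrm (u t)).
Proof.
pose t := (2 / C2 + 2 * C1) / rho.
have t0 : 0 <= t by rewrite divr_ge0 ?addr_ge0 ?divr_ge0 ?mulr_ge0// ltW.
have et : 2 / C2 + 2 * C1 <= expR (rho * t).
  apply: le_trans (expR_ge1Dx _).
  by rewrite /t [rho * _]mulrC divfK ?gt_eqF// lerDr.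
exists t => //; split=> x u ux Xx.
  apply: (le_trans (decay ux t0 Xx)); rewrite ler_wpM2r ?nrm_ge0//.
  rewrite mulNr expRN ler_pdivrMr ?expR_gt0//.
  have : 0 < 2 / C2 by rewrite divr_gt0.
  by move: et; lra.
apply: le_trans (growth ux t0 Xx); rewrite ler_wpM2r ?nrm_ge0//.
rewrite mulrC -ler_pdivrMr//.
by move: et; have := C10; lra.
Qed.

(** The projections of a dichotomy are bounded: after a long time the
unstable component dominates the trajectory. *)
Lemma dichotomy_split_bound (t : R) : 0 <= t ->
  (forall x u, flow A x u -> S x -> nrm (u t) <= 2^-1 * nrm x) ->
  (forall x u, flow A x u -> T x -> 2 * nrm x <= nrm (u t)) ->
  forall s r, S s -> T r ->
  nrm s <= (expR (k * t) + 2) * nrm (s + r) /\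
  nrm r <= (expR (k * t) + 2) * nrm (s + r).
Proof.
move=> t0 dec gro s r Ss Tr.
have [u us] := flow_exists lA (ltW c0) Ac s.
have [v vr] := flow_exists lA (ltW c0) Ac r.
have h1 := dec _ _ us Ss; have h2 := gro _ _ vr Tr.
have := flow_growth (ltW c0) Ac (flow_lin 1 lA us vr) t0.
rewrite !scale1r -/k; set E := expR _ => h3.
have E1 : 1 <= E.
  by rewrite -expR0 ler_expR mulr_ge0// addr_ge0// sqr_ge0.
have x0 := nrm_ge0 (s + r).
have {}h3 : nrm (u t + v t) <= E * nrm (s + r).
  rewrite -(ler_pXn2r (_ : (0 < 2)%N))// ?nnegrE ?nrm_ge0 ?mulr_ge0 ?expR_ge0//.
  rewrite (le_trans h3)// exprMn mulrC ler_wpM2r ?sqr_ge0//.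
  by rewrite expr2 ler_peMl// expR_ge0.
have := nrm_dist (v t) (- u t); rewrite opprK nrmN (addrC (v t)) => h4.
have := nrm_dist s (- r); rewrite opprK nrmN => h5.
have Ex := ler_wpM2r x0 E1.
by split; move: h1 h2 h3 h4 h5 x0 Ex; lra.
Qed.

(** The lower bound of [z - A] is uniform on the imaginary axis, or on the closed
right half-plane when [T] is trivial; invertibility is then carried in from
infinity, along the axis or along a horizontal half-line. *)
Lemma dichotomy_resolvent (z : R[i]) :
  complex.Re z = 0 \/ (T `<=` [set 0]) /\ 0 <= complex.Re z ->
  boundedly_invertible (fun x => z *: x - A x).
Proof.
move=> zP; have [t t0 [dec gro]] := dichotomy_time.
pose E := expR (k * t); pose B := 4 * E * t.
have E0 : 0 <= E by exact: expR_ge0.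
have B0 : 0 <= B by rewrite !mulr_ge0.
have zS (Q : set X) w x : closed Q ->
    (forall (a : R[i]) x y, Q x -> Q y -> Q (a *: x + y)) ->
    flow_invariant Q -> Q x -> Q (w *: x - A x).
  move=> clQ lQ iQ Qx; apply: (lQ) => //; rewrite -scaleN1r.
  have QAx := flow_invariant_generator clQ lQ iQ Qx.
  have Q0 : Q 0 by have := lQ (-1) _ _ Qx Qx; rewrite scaleN1r addNr.
  by rewrite -[_ *: _]addr0; exact: lQ.
have bnd w : complex.Re w = 0 \/ (T `<=` [set 0]) /\ 0 <= complex.Re w ->
    forall x, nrm x <= (2 * B * (E + 2) + 1) * nrm (w *: x - A x).
  move=> wP x; have [s [r [Ss Tr xE]]] := STX x.
  have Ssw := zS S w s clS linS invS Ss.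
  have Trw := zS T w r clT linT invT Tr.
  have := dichotomy_split_bound t0 dec gro Ssw Trw.
  have -> : w *: s - A s + (w *: r - A r) = w *: x - A x.
    by rewrite xE (linD lA) scalerDr opprD addrACA.
  rewrite -/E; move=> [hs hr].
  have [u us] := flow_exists lA (ltW c0) Ac s.
  have [v vr] := flow_exists lA (ltW c0) Ac r.
  have w0 : 0 <= complex.Re w by case: wP => [->|[]].
  have ds := resolvent_bound_decay lA c0 Ac us t0 w0 (dec _ _ us Ss).
  have dr : nrm r <= B * nrm (w *: r - A r).
    case: wP => [wr|[T0 _]]; last first.
      by rewrite (T0 _ Tr) nrm0 mulr_ge0// nrm_ge0.
    apply: (resolvent_bound_growth lA c0 Ac vr t0) => //; first by rewrite wr.
    exact: gro vr Tr.
  have := nrmD s r; rewrite -xE => h.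
  have := ler_wpM2l B0 hs; have := ler_wpM2l B0 hr.
  rewrite -/k -/E -/B in ds; have := nrm_ge0 (w *: x - A x).
  by move: h ds dr; lra.
have Mp : 0 < 2 * B * (E + 2) + 1.
  by rewrite ltr_wpDl// !mulr_ge0// addr_ge0.
have [d [d1 dP]] : exists d : R[i], cabs d = 1 /\ forall s : R, 0 <= s ->
    complex.Re (z + s%:C * d) = 0 \/
    (T `<=` [set 0]) /\ 0 <= complex.Re (z + s%:C * d).
  case: zP => [z0|[T0 z0]].
    exists 'i; split=> [|s _]; first exact: cabs_i.
    by left; case: z z0 => a b /= ->; rewrite mul0r mulr0 subr0 addr0.
  exists 1; split=> [|s s0]; first exact: cabs1.
  right; split=> //; rewrite mulr1; case: z z0 => a b /= a0.
  by rewrite addr_ge0.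
apply: (resolvent_half_line lA (ltW c0) Ac Mp d1) => s x s0.
by apply: bnd; exact: dP.
Qed.

End dichotomy_to_resolvent.

(** * The spectral projection as a limit of averages over the circle *)

Section circle_average.
Context {R : realType} {X : hilbertType R}.
Implicit Types (F B : X -> X) (g h : R[i] -> X -> X) (z w : R[i]).

Lemma half_add (x : X) : 2^-1 *: (x + x) = x.
Proof.
by rewrite -mulr2n -[x *+ 2]scaler_nat scalerA mulVf ?pnatr_eq0// scale1r.
Qed.

Lemma cabs_half : cabs (2^-1 : R[i]) = 2^-1.
Proof. by rewrite cabsV cabs_nat. Qed.

Definition inverse_of (f g : X -> X) := cancel f g /\ cancel g f.

Lemma inverse_of_unique (f g h : X -> X) :
  inverse_of f g -> inverse_of f h -> g =1 h.
Proof. by move=> [fg gf] [fh hf] x; rewrite -{1}(hf x) fg. Qed.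

Definition circle z := cabs z = 1.

Lemma circleN z : circle z -> circle (- z).
Proof. by rewrite /circle cabsN. Qed.

Lemma circle1 : circle 1. Proof. exact: cabs1. Qed.

Lemma circle_sqrt z : circle z -> circle (sqrtC z).
Proof.
rewrite /circle => z1; apply/eqP; rewrite -(@eqrXn2 _ 2)// ?cabs_ge0//.
by rewrite expr1n expr2 -cabsM -expr2 sqrtCK z1.
Qed.

(** Partial fractions: [2 / (1 - z^2 f^2) = 1 / (1 - z f) + 1 / (1 + z f)]. *)
Lemma inverse_of_sqr (f gp gm : X -> X) z : linear f ->
  inverse_of (fun x => x - z *: f x) gp ->
  inverse_of (fun x => x - (- z) *: f x) gm ->
  inverse_of (fun x => x - z ^+ 2 *: f (f x)) (fun x => 2^-1 *: (gp x + gm x)).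
Proof.
move=> lf [pK Kp] [mK Km].
have sqr1 x : x - z ^+ 2 *: f (f x) =
    (x - (- z) *: f x) - z *: f (x - (- z) *: f x).
  rewrite scaleNr opprK (linD lf) (linZ lf) scalerDr scalerA -expr2 opprD addrA.
  by rewrite addrK.
have sqr2 x : x - z ^+ 2 *: f (f x) =
    (x - z *: f x) - (- z) *: f (x - z *: f x).
  rewrite scaleNr opprK (linB lf) (linZ lf) scalerBr scalerA -expr2 addrA.
  by rewrite subrK.
split=> x.
  rewrite {1}sqr1 sqr2 pK mK scaleNr opprK.
  by rewrite addrACA subrr addr0 half_add.
have lin a b : (fun x => x - z ^+ 2 *: f (f x)) (2^-1 *: (a + b)) =
    2^-1 *: ((a - z ^+ 2 *: f (f a)) + (b - z ^+ 2 *: f (f b))).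
  rewrite !(linZ lf) !(linD lf) scalerA mulrC -scalerA -scalerBr.
  rewrite [z ^+ 2 *: _]scalerDr.
  by rewrite opprD addrACA.
rewrite lin sqr2 sqr1 Kp Km scaleNr opprK.
by rewrite addrACA subrr addr0 half_add.
Qed.

(** Resolvent identity: the difference is [(z - w) g F h]. *)
Lemma inverse_of_lipschitz F (c M : R) (z w : R[i]) (g h : X -> X) :
  linear F -> linear g ->
  0 <= M -> bounded_by c F -> bounded_by M g -> bounded_by M h ->
  inverse_of (fun x => x - z *: F x) g ->
  inverse_of (fun x => x - w *: F x) h ->
  forall x, nrm (g x - h x) <= M ^+ 2 * c * cabs (z - w) * nrm x.
Proof.
move=> lF lg M0 Fc gM hM [gK Kg] [hK Kh] x.
have -> : g x - h x = (z - w) *: g (F (h x)).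
  rewrite -{1}(gK (h x)) -{1}(Kh x) -(linB lg) -(linZ lg); congr (g _).
  by rewrite opprB addrC addrA subrK scalerBl.
rewrite nrmZ.
have := cabs_ge0 (z - w); move: (cabs _) => d d0.
have h1 := gM (F (h x)); have h2 := ler_wpM2l M0 (Fc (h x)).
have cn : c * nrm (h x) <= c * (M * nrm x).
  have [c0|c0] := leP 0 c; first exact: ler_wpM2l.
  have := Fc (h x); have := nrm_ge0 (F (h x)) => a b.
  have : nrm (h x) = 0.
    by apply/le_anti; rewrite nrm_ge0 andbT; move: c0 a b; nra.
  move=> hx0; have x0 : nrm x = 0.
    by rewrite -{1}(Kh x) (nrm0_eq0 hx0) (lin0 lF) scaler0 subr0 nrm0.
  by rewrite hx0 x0 !mulr0.
have h3 := ler_wpM2l M0 cn.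
have h4 := ler_wpM2l d0 (le_trans h1 (le_trans h2 h3)).
by rewrite (le_trans h4)//; apply: eq_ler; ring.
Qed.

(** From inverses [g z] of [1 - z F], [root_average g k z] is the inverse of
[1 - z F ^ (2 ^ k)]: it is the average of [g] over the [2 ^ k]-th roots of
[z]. *)
Fixpoint root_average g (k : nat) (z : R[i]) (x : X) : X :=
  if k is j.+1 then
    2^-1 *: (root_average g j (sqrtC z) x + root_average g j (- sqrtC z) x)
  else g z x.

Section one_operator.
Variables (F : X -> X) (c M : R) (g : R[i] -> X -> X).
Hypotheses (lF : linear F) (c0 : 0 <= c) (Fc : bounded_by c F).
Hypotheses (M0 : 0 <= M)
  (gF : forall z, circle z -> inverse_of (fun x => x - z *: F x) (g z))
  (gM : forall z, circle z -> bounded_by M (g z)).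

Local Notation G := (root_average g).

Lemma linear_sub_scale f z : linear f -> linear (fun x : X => x - z *: f x).
Proof.
move=> lf a x y; rewrite lf scalerDr opprD addrACA scalerBr !scalerA.
by rewrite (mulrC z).
Qed.

Lemma root_average_inverse k z : circle z ->
  inverse_of (fun x => x - z *: iter (2 ^ k) F x) (G k z).
Proof.
elim: k z => [|k IH] z z1; first exact: gF.
have s1 := circle_sqrt z1.
have := inverse_of_sqr (linear_iter _ lF) (IH _ s1) (IH _ (circleN s1)).
rewrite sqrtCK expnS mul2n -addnn.
suff -> : (fun x : X => x - z *: iter (2 ^ k) F (iter (2 ^ k) F x)) =
  (fun x : X => x - z *: iter (2 ^ k + 2 ^ k) F x) by [].
by apply/funext => x; rewrite iterD.
Qed.

Lemma linear_root_average k z : circle z -> linear (G k z).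
Proof.
move=> z1; have [GK KG] := root_average_inverse k z1.
by apply: can_linear _ GK KG; apply: linear_sub_scale; exact: linear_iter.
Qed.

Lemma root_average_bound k z : circle z -> bounded_by M (G k z).
Proof.
elim: k z => [|k IH] z z1 x; first exact: gM.
have s1 := circle_sqrt z1.
rewrite /= nrmZ; have := nrmD (G k (sqrtC z) x) (G k (- sqrtC z) x).
have := IH _ s1 x; have := IH _ (circleN s1) x.
  rewrite cabs_half.
lra.
Qed.

Lemma root_average_sqr k z x : circle z ->
  G k.+1 (z ^+ 2) x = 2^-1 *: (G k z x + G k (- z) x).
Proof.
move=> z1; have z21 : circle (z ^+ 2) by rewrite /circle expr2 cabsM z1 mulr1.
have := inverse_of_sqr (linear_iter (2 ^ k) lF) (root_average_inverse k z1)
  (root_average_inverse k (circleN z1)).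
move=> h; apply: (inverse_of_unique _ h).
have := root_average_inverse k.+1 z21.
rewrite expnS mul2n -addnn.
suff -> : (fun x : X => x - z ^+ 2 *: iter (2 ^ k) F (iter (2 ^ k) F x)) =
  (fun x : X => x - z ^+ 2 *: iter (2 ^ k + 2 ^ k) F x) by [].
by apply/funext => y; rewrite iterD.
Qed.

(** Because [|z + w|^2 + |z - w|^2 = 4] and [(7 / 5)^2 < 2]. It follows that points
of the circle get [7 / 5] times closer when suitable square roots are taken,
so that averaging flattens [root_average g k] geometrically. *)
Lemma circle_far z w : circle z -> circle w ->
  7 / 5 <= cabs (z + w) \/ 7 / 5 <= cabs (z - w).
Proof.
move=> z1 w1.
have : cabs (z + w) ^+ 2 + cabs (z - w) ^+ 2 = 4.
  have : cabs z ^+ 2 = 1 by rewrite z1 expr1n.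
  have : cabs w ^+ 2 = 1 by rewrite w1 expr1n.
  by rewrite !cabs_sqr; case: (z) => a b; case: (w) => p q/=; lra.
have := cabs_ge0 (z + w); have := cabs_ge0 (z - w).
set p := cabs (z + w); set q := cabs (z - w) => q0 p0 pq.
have [?|p7] := leP (7 / 5) p; [by left|right].
rewrite leNgt; apply/negP => q7.
have : p ^+ 2 < (7 / 5) ^+ 2 by rewrite ltr_pXn2r// nnegrE divr_ge0.
have : q ^+ 2 < (7 / 5) ^+ 2 by rewrite ltr_pXn2r// nnegrE divr_ge0.
by rewrite ![(7 / 5) ^+ 2]expr2; lra.
Qed.

Lemma root_average_lipschitz k z w x : circle z -> circle w ->
  nrm (G k z x - G k w x) <=
    M ^+ 2 * c * (5 / 7) ^+ k * cabs (z - w) * nrm x.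
Proof.
elim: k z w => [|k IH] z w z1 w1.
  rewrite expr0 mulr1; apply: inverse_of_lipschitz => //.
  - exact: (linear_root_average 0 z1).
  - exact: gM.
  - exact: gM.
  - exact: gF.
  - exact: gF.
have far p q : circle p -> circle q -> 7 / 5 <= cabs (p + q) ->
    nrm (G k.+1 (p ^+ 2) x - G k.+1 (q ^+ 2) x) <=
    M ^+ 2 * c * (5 / 7) ^+ k.+1 * cabs (p ^+ 2 - q ^+ 2) * nrm x.
  move=> p1 q1 pq; rewrite !root_average_sqr// -scalerBr nrmZ.
  rewrite cabs_half.
  rewrite opprD addrACA.
  have h1 := IH _ _ p1 q1; have h2 := IH _ _ (circleN p1) (circleN q1).
  have E : cabs (- p - - q) = cabs (p - q) by rewrite -opprD cabsN.
  rewrite E in h2.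
  have h3 := nrmD (G k p x - G k q x) (G k (- p) x - G k (- q) x).
  have h4 : cabs (p - q) <= 5 / 7 * cabs (p ^+ 2 - q ^+ 2).
    by rewrite subr_sqr cabsM; have := cabs_ge0 (p - q); nra.
  have L0 : 0 <= M ^+ 2 * c * (5 / 7) ^+ k * nrm x.
    by rewrite !mulr_ge0 ?nrm_ge0 ?exprn_ge0 ?divr_ge0.
  have h5 := ler_wpM2l L0 h4; rewrite [(5 / 7) ^+ k.+1]exprS.
  by move: h1 h2 h3 h5; lra.
have zs := circle_sqrt z1; have ws := circle_sqrt w1.
have [zw|zw] := circle_far zs ws.
  by have := far _ _ zs ws zw; rewrite !sqrtCK.
have := far _ _ zs (circleN ws) zw; by rewrite sqrrN !sqrtCK.
Qed.

End one_operator.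

(** [P] is the uniform limit of the averages over the [2 ^ k]-th roots of
unity; for inverses [g z] of [1 - z F] it is the spectral projection of [F]
on the part inside the unit disc. *)
Definition circle_mean g (P : X -> X) := exists K : R, 0 <= K /\
  forall k x, nrm (P x - root_average g k 1 x) <= K * (5 / 7) ^+ k * nrm x.

Lemma cvg_57 (K : R) : K * (5 / 7) ^+ k @[k --> \oo] --> (0 : R).
Proof.
rewrite -[X in _ --> X](mulr0 K); apply: cvgM; first exact: cvg_cst.
by apply: cvg_expr; rewrite ger0_norm; lra.
Qed.

Lemma circle_mean_dist g h P Q (d : R) : 0 <= d ->
  (forall z x, circle z -> nrm (g z x - h z x) <= d * nrm x) ->
  circle_mean g P -> circle_mean h Q ->
  forall x, nrm (P x - Q x) <= d * nrm x.
Proof.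
move=> d0 gh [K [K0 gP]] [L [L0 hQ]] x.
have ave k z y : circle z ->
    nrm (root_average g k z y - root_average h k z y) <= d * nrm y.
  elim: k z => [|k IH] z z1; first exact: gh.
  have zs := circle_sqrt z1.
  rewrite /= -scalerBr nrmZ opprD addrACA.
  rewrite cabs_half.
  set u := _ - _; set v := _ - _; have := nrmD u v.
  by have := IH _ zs; have := IH _ (circleN zs); rewrite -/u -/v; lra.
rewrite -subr_le0.
apply: (@le0_squeeze _ _ (fun k => (K + L) * nrm x * (5 / 7) ^+ k)).
  exact: cvg_57.
move=> k; have := gP k x; have := hQ k x; have := ave k _ x circle1.
set u := root_average g _ _ _; set v := root_average h _ _ _ => h1 h2 h3.
have -> : P x - Q x = (P x - u) + (u - v) - (Q x - v).
  by rewrite subrKA [in RHS]opprB addrA subrK.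
have := nrmB (P x - u + (u - v)) (Q x - v); have := nrmD (P x - u) (u - v).
by move: h1 h2 h3; lra.
Qed.

(** Consecutive averages at [1] differ by half the variation of [root_average g k]
between [1] and [-1], hence converge. *)
Theorem circle_mean_exists F (c M : R) g : linear F -> 0 <= c ->
  bounded_by c F -> 0 <= M ->
  (forall z, circle z -> inverse_of (fun x => x - z *: F x) (g z)) ->
  (forall z, circle z -> bounded_by M (g z)) ->
  exists P, [/\ circle_mean g P, linear P,
    exists2 C : R, 0 < C & bounded_by C P,
    forall x, P (P x) = P x &
    forall B (b : R), linear B -> 0 <= b -> bounded_by b B ->
      (forall x, B (F x) = F (B x)) -> forall x, P (B x) = B (P x)].
Proof.
move=> lF c0 Fc M0 gF gM.
pose G := root_average g; pose L := M ^+ 2 * c; pose q : R := 5 / 7.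
have L0 : 0 <= L by rewrite mulr_ge0// sqr_ge0.
have q0 k : 0 <= q ^+ k by rewrite exprn_ge0// divr_ge0.
have c1 := circle1; have cN1 := circleN c1.
have G1 k x : nrm (G k 1 x - G k (-1) x) <= 2 * L * q ^+ k * nrm x.
  have := root_average_lipschitz lF c0 Fc M0 gF gM k x c1 cN1.
  rewrite opprK -mulr2n cabs_nat -/L -/q -/G => /le_trans; apply.
  by apply: eq_ler; ring.
have GS k x : nrm (G k.+1 1 x - G k 1 x) <= L * nrm x * q ^+ k.
  have := root_average_sqr lF gF k x c1; rewrite expr1n -/G => ->.
  have -> : 2^-1 *: (G k 1 x + G k (-1) x) - G k 1 x =
      - (2^-1 *: (G k 1 x - G k (-1) x)).
    set u := G k 1 x; set v := G k _ x.
    rewrite -[X in _ - X]half_add.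
    by rewrite -scalerBr opprD addrACA subrr add0r -scalerN opprB.
  rewrite nrmN nrmZ.
  rewrite cabs_half.
  by have := G1 k x; lra.
have q01 : 0 <= q < 1 by rewrite /q; lra.
have /choice[P PG] x := nrm_geometric_cvg q01 (GS ^~ x).
pose K := L / (1 - q).
have K0 : 0 <= K by rewrite divr_ge0// /q; lra.
have {}PG k x : nrm (P x - G k 1 x) <= K * q ^+ k * nrm x.
  by rewrite (le_trans (PG x k))// /K; apply: eq_ler; ring.
have PGm k x : nrm (P x - G k (-1) x) <= (K + 2 * L) * q ^+ k * nrm x.
  rewrite -(subrKA (G k 1 x)) (le_trans (nrmD _ _))//.
  by have := PG k x; have := G1 k x; lra.
have lG k : linear (G k 1) by exact: linear_root_average.
have GM k : bounded_by M (G k 1) by exact: root_average_bound.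
have q_cvg : q ^+ k @[k --> \oo] --> (0 : R).
  by have := cvg_57 1; under eq_fun do rewrite mul1r.
have lP : linear P.
  move=> a x y; apply/eqP; rewrite -subr_eq0; apply/eqP.
  pose D := K * nrm (a *: x + y) + (cabs a * (K * nrm x) + K * nrm y).
  apply: (@nrm_squeeze _ _ _ D (fun k => q ^+ k) q_cvg) => k.
  rewrite -(subrKA (G k 1 (a *: x + y))) {2}(lG k).
  rewrite -[X in _ + X]opprB -/(_ - _).
  have -> : a *: P x + P y - (a *: G k 1 x + G k 1 y) =
      a *: (P x - G k 1 x) + (P y - G k 1 y).
    by rewrite opprD addrACA -scalerBr.
  rewrite (le_trans (nrmB _ _))// /D mulrDl lerD//.
    by rewrite (le_trans (PG _ _))// mulrAC.
  rewrite (le_trans (nrmD _ _))// mulrDl lerD//.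
    by rewrite nrmZ -mulrA ler_wpM2l ?cabs_ge0// (le_trans (PG _ _))// mulrAC.
  by rewrite (le_trans (PG _ _))// mulrAC.
have PM x : nrm (P x) <= (K + M) * nrm x.
  rewrite -(subrK (G 0%N 1 x) (P x)) (le_trans (nrmD _ _))// mulrDl lerD//.
    by have := PG 0%N x; rewrite expr0 mulr1.
  exact: GM.
exists P; split=> //.
- by exists K; split=> // k x; exact: PG.
- exists (K + M + 1) => [|x]; first by rewrite ltr_wpDl// addr_ge0.
  by rewrite (le_trans (PM x))// ler_wpM2r ?nrm_ge0// lerDl.
- (* The inverses of [1 - f] and [1 + f] compose to the inverse of [1 - f ^ 2],
     and all three converge to [P]. *)
  have GG k x : G k.+1 1 x = G k (-1) (G k 1 x).
    have [p1 p2] := root_average_inverse lF gF k c1.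
    have [m1 m2] := root_average_inverse lF gF k cN1.
    apply: (inverse_of_unique (h := fun x => G k (-1) (G k 1 x))
      (root_average_inverse lF gF k.+1 c1)).
    have fE y : y - 1 *: iter (2 ^ k.+1) F y =
        (y - (-1) *: iter (2 ^ k) F y) -
        1 *: iter (2 ^ k) F (y - (-1) *: iter (2 ^ k) F y).
      rewrite !scaleN1r opprK !scale1r (linD (linear_iter _ lF)) opprD addrA.
      by rewrite addrK expnS mul2n -addnn iterD.
    by split=> y; rewrite /G fE; [rewrite p1 m1|rewrite m2 p2].
  move=> x; apply/eqP; rewrite -subr_eq0; apply/eqP.
  pose D := (K + 2 * L) * nrm (P x) + M * (K * nrm x) + K * nrm x.
  apply: (@nrm_squeeze _ _ _ D (fun k => q ^+ k) q_cvg) => k.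
  have -> : P (P x) - P x = (P (P x) - G k (-1) (P x))
      + G k (-1) (P x - G k 1 x) - (P x - G k.+1 1 x).
    rewrite [G k (-1) (_ - _)](linB (linear_root_average lF gF k cN1)) GG.
    by rewrite subrKA [in RHS]opprB addrA subrK.
  rewrite (le_trans (nrmB _ _))// /D mulrDl lerD//.
    rewrite (le_trans (nrmD _ _))// mulrDl lerD//.
      by rewrite (le_trans (PGm _ _))// mulrAC.
    rewrite (le_trans (root_average_bound gM k cN1 _))// -mulrA ler_wpM2l//.
    by rewrite (le_trans (PG _ _))// mulrAC.
  rewrite (le_trans (PG _ _))// mulrAC (ler_wpM2l (mulr_ge0 K0 (nrm_ge0 x)))//.
  by rewrite exprS ler_piMl// /q; lra.
- move=> B b lB b0 Bb BF x.
  have BG k y : B (G k 1 y) = G k 1 (B y).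
    have [p1 p2] := root_average_inverse lF gF k c1.
    have BFk n (v : X) : B (iter n F v) = iter n F (B v).
      by elim: n => //= n IH; rewrite BF IH.
    by rewrite -{2}(p2 y) scale1r (linB lB) BFk -[iter _ F _]scale1r /G p1.
  apply/eqP; rewrite -subr_eq0; apply/eqP.
  pose D := K * nrm (B x) + b * (K * nrm x).
  apply: (@nrm_squeeze _ _ _ D (fun k => q ^+ k) q_cvg) => k.
  have -> : P (B x) - B (P x) = (P (B x) - G k 1 (B x)) - B (P x - G k 1 x).
    by rewrite (linB lB) BG opprB addrA subrK.
  rewrite (le_trans (nrmB _ _))// /D mulrDl lerD//.
    by rewrite (le_trans (PG _ _))// mulrAC.
  rewrite (le_trans (Bb _))// -mulrA ler_wpM2l//.
  by rewrite (le_trans (PG _ _))// mulrAC.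
Qed.

(** If [1 - w F] is invertible on the closed disc, the projections of [r F] form
a Lipschitz family of idempotents for [0 <= r <= 1] which starts at the
identity, hence it is constant. *)
Lemma circle_mean_disc F (f M : R) h P : linear F -> 0 <= f -> bounded_by f F ->
  0 <= M ->
  (forall w, cabs w <= 1 -> inverse_of (fun x => x - w *: F x) (h w)) ->
  (forall w, cabs w <= 1 -> bounded_by M (h w)) ->
  circle_mean h P -> forall x, P x = x.
Proof.
move=> lF f0 Ff M0 hF hM hP.
pose g (r : R) z := h (r%:C * z).
have rz (r : R) z : 0 <= r <= 1 -> circle z -> cabs (r%:C * z) <= 1.
  by move=> /andP[r0 r1] z1; rewrite cabsM z1 mulr1 cabs_real ger0_norm.
have same g1 g2 P1 P2 : (forall z, circle z -> g1 z = g2 z) ->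
    circle_mean g1 P1 -> circle_mean g2 P2 -> P1 =1 P2.
  move=> g12 gP1 gP2 x; apply/eqP; rewrite -subr_eq0; apply/eqP/nrm_le0_eq0.
  rewrite -(mul0r (nrm x)); apply: (circle_mean_dist (lexx 0) _ gP1 gP2).
  by move=> z y z1; rewrite (g12 _ z1) subrr nrm0 mul0r.
have ex (r : R) : 0 <= r <= 1 -> exists Q, circle_mean (g r) Q /\
    forall x, Q (Q x) = Q x /\ linear Q.
  move=> r01; have /andP[r0 r1] := r01.
  have lrF : linear (fun x => r%:C *: F x).
    by move=> a x y; rewrite lF scalerDr !scalerA mulrC.
  have [||z z1|Q [gQ lQ _ QQ _]] := @circle_mean_exists _ f M (g r) lrF f0 _ M0.
  - move=> x; rewrite nrmZ cabs_real ger0_norm//.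
    by apply: le_trans (Ff x); rewrite ler_piMl ?nrm_ge0.
  - move=> z z1; have := hF _ (rz _ _ r01 z1).
    suff -> : (fun x : X => x - (r%:C * z) *: F x) =
      (fun x : X => x - z *: (r%:C *: F x)) by [].
    by apply/funext => x; rewrite scalerA mulrC.
  - exact: hM (rz _ _ r01 z1).
  - by exists Q.
pose d := M ^+ 2 * f; have d0 : 0 <= d by rewrite mulr_ge0// sqr_ge0.
have gd (r s : R) z x : 0 <= r <= 1 -> 0 <= s <= 1 -> circle z ->
    nrm (g r z x - g s z x) <= d * `|r - s| * nrm x.
  move=> r01 s01 z1; have rz1 := rz _ _ r01 z1; have sz1 := rz _ _ s01 z1.
  have lg : linear (g r z).
    have [gK Kg] := hF _ rz1; apply: can_linear _ gK Kg.
    exact: linear_sub_scale.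
  have := inverse_of_lipschitz lF lg M0 Ff (hM _ rz1) (hM _ sz1) (hF _ rz1)
    (hF _ sz1) x.
  by rewrite -mulrBl -rmorphB/= cabsM z1 mulr1 cabs_real.
pose N := (Num.truncn (d * 2)).+1.
have N0 : 0 < N%:R :> R by rewrite ltr0n.
have dN : d / N%:R <= 2^-1.
  have : d * 2 < N%:R by exact: truncnS_gt.
  by rewrite ler_pdivrMr//; lra.
have iN (i : nat) : (i <= N)%N -> 0 <= (i%:R / N%:R : R) <= 1.
  move=> iN; apply/andP; split; first by rewrite divr_ge0 ?ler0n.
  by rewrite ler_pdivrMr// mul1r ler_nat.
have H (i : nat) : (i <= N)%N ->
    forall Q, circle_mean (g (i%:R / N%:R)) Q -> Q =1 id.
  elim: i => [_ Q|i IH iN1 Q gQ].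
    rewrite mul0r => gQ; apply: (same _ (fun _ x => x) _ _ _ gQ).
      move=> z z1; apply/funext => x.
      have r00 : 0 <= (0 : R) <= 1 by rewrite lexx ler01.
      have [gK _] := hF _ (rz 0 z r00 z1).
      by have := gK x; rewrite mul0r scale0r subr0 /g mul0r.
    have id_ave k (z : R[i]) x : root_average (fun _ => id) k z x = x.
      by elim: k z x => //= k IH z x; rewrite !IH half_add.
    by exists 0; split=> // k x; rewrite id_ave subrr nrm0 !mul0r.
  have i01 := iN _ (ltnW iN1); have j01 := iN _ iN1.
  have [Q0 [gQ0 _]] := ex _ i01; have Q0id := IH (ltnW iN1) _ gQ0.
  have [Q1 [gQ1 Q1P]] := ex _ j01.
  have dQ x : nrm (Q0 x - Q1 x) <= 2^-1 * nrm x.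
    have e : d * `|i%:R / N%:R - i.+1%:R / N%:R| = d / N%:R.
      rewrite -mulrBl -natr1 opprD addrA subrr add0r normrM normrN normr1 mul1r.
      by rewrite ger0_norm// invr_ge0.
    have := circle_mean_dist (d := d / N%:R) _ _ gQ0 gQ1 x.
    move=> /(_ (divr_ge0 d0 (ltW N0))); rewrite -e => h1.
    apply: le_trans (h1 _) _; last by rewrite e ler_wpM2r ?nrm_ge0.
    by move=> z y z1; exact: gd.
  have Q1id x : Q1 x = x.
    have [Q1Q1 lQ1] := Q1P x; have := dQ (x - Q1 x).
    rewrite Q0id (linB lQ1) Q1Q1 subrr subr0 => h1.
    have : nrm (x - Q1 x) <= 0 by move: h1; lra.
    by move=> /nrm_le0_eq0/eqP; rewrite subr_eq0 => /eqP.
  by move=> x; rewrite (same _ _ _ _ (fun _ _ => erefl) gQ gQ1) Q1id.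
have [Q [gQ _]] := ex 1 (introT andP (conj ler01 (lexx 1))).
have Qid : Q =1 id by apply: (H N (leqnn N)); rewrite divff// gt_eqF.
move=> x; rewrite -[RHS]Qid; apply: (same _ _ _ _ _ hP gQ) => z _.
by rewrite /g mul1r.
Qed.

End circle_average.

(** * Lyapunov estimates from the Cayley transform *)

Section lyapunov.
Context {R : realType} {X : hilbertType R}.
Variables (A F : X -> X) (c f : R).
Hypotheses (c0 : 0 < c) (Ac : bounded_by c A).
Hypotheses (lF : linear F) (f0 : 0 < f) (Ff : bounded_by f F).
Hypothesis FA : forall x, F (A x) = A (F x).
(* [F] is the Cayley transform [(A + a) / (A - a)] with [a = 2 c]. *)
Hypothesis Fcayley : forall y,
  F (A y - (2 * c)%:C *: y) = A y + (2 * c)%:C *: y.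
Variables (n : nat).
Hypothesis n0 : (0 < n)%N.

Definition orbit_energy (m : nat) x := \sum_(j < m) nrm (iter j F x) ^+ 2.

Let rate m y := \sum_(j < m) rdot (iter j F (A y)) (iter j F y).

Lemma orbit_energy_shift m x :
  orbit_energy m (F x) = orbit_energy m x - nrm x ^+ 2 + nrm (iter m F x) ^+ 2.
Proof.
rewrite /orbit_energy; elim: m => [|m IH].
  by rewrite !big_ord0 add0r addNr.
by rewrite !big_ord_recr/= IH -iterSr iterS; lra.
Qed.

Lemma orbit_energy_ge x : nrm x ^+ 2 <= orbit_energy n x.
Proof.
rewrite /orbit_energy -(prednK n0) big_ord_recl/= lerDl.
by apply: sumr_ge0 => j _; exact: sqr_ge0.
Qed.

Definition energy_bound := \sum_(j < n) (f ^+ j) ^+ 2.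

Lemma energy_bound_ge1 : 1 <= energy_bound.
Proof.
rewrite /energy_bound -(prednK n0) big_ord_recl/= expr0 expr1n lerDl.
by apply: sumr_ge0 => j _; exact: sqr_ge0.
Qed.

Lemma orbit_energy_le x : orbit_energy n x <= energy_bound * nrm x ^+ 2.
Proof.
rewrite /orbit_energy /energy_bound mulr_suml; apply: ler_sum => j _.
rewrite -exprMn ler_pXn2r
  ?nnegrE ?nrm_ge0 ?mulr_ge0 ?exprn_ge0 ?nrm_ge0 ?(ltW f0)//.
exact: bounded_by_iter _ (ltW f0) Ff x.
Qed.

(** Polarization [|(A + a) y|^2 - |(A - a) y|^2 = 4 a Re <A y, y>], summed along
the orbit of [F]. *)
Let rate_cayley y : 8 * c * rate n y =
  nrm (iter n F (A y - (2 * c)%:C *: y)) ^+ 2 -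
  nrm (A y - (2 * c)%:C *: y) ^+ 2.
Proof.
have := orbit_energy_shift n (A y - (2 * c)%:C *: y); rewrite Fcayley => E.
have : orbit_energy n (A y + (2 * c)%:C *: y) -
    orbit_energy n (A y - (2 * c)%:C *: y) = 8 * c * rate n y.
  rewrite /orbit_energy /rate -sumrB mulr_sumr; apply: eq_bigr => j _.
  have lj := linear_iter j lF.
  rewrite (linD lj) (linB lj) !(linZ lj) !nrmD_sqr nrmN rdotNr !rdotZr.
  by ring.
by move: E; lra.
Qed.

Lemma orbit_energy_derivative m x u (t : R) : flow A x u -> 0 < t ->
  is_derive t (1 : R) (fun s => orbit_energy m (u s)) (2 * rate m (u t)).
Proof.
move=> [_ _ du] t0; elim: m => [|m IH].
  rewrite /rate big_ord0 mulr0.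
  have -> : (fun s => orbit_energy 0 (u s)) = cst 0.
    by apply/funext => s; rewrite /orbit_energy big_ord0.
  exact: is_derive_cst.
have -> : (fun s => orbit_energy m.+1 (u s)) =
    (fun s => orbit_energy m (u s)) + (fun s => nrm (iter m F (u s)) ^+ 2).
  by apply/funext => s; rewrite /orbit_energy big_ord_recr.
rewrite /rate big_ord_recr/= mulrDr; apply: is_deriveD.
apply: energy_derivative.
apply: (time_derivative_comp (linear_iter m lF) (_ : 0 < f ^+ m)).
- by rewrite exprn_gt0.
- by move=> y; exact: bounded_by_iter _ (ltW f0) Ff y.
- exact: du.
Qed.

Lemma iter_commute j x : iter j F (A x) = A (iter j F x).
Proof. by elim: j => //= j ->; rewrite FA. Qed.

Lemma orbit_energy_continuous m x u : flow A x u ->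
  {within `[0, +oo[, continuous (fun s => orbit_energy m (u s))}.
Proof.
move=> ux; elim: m => [|m IH].
  have -> : (fun s => orbit_energy 0 (u s)) = cst 0.
    by apply/funext => s; rewrite /orbit_energy big_ord0.
  by move=> s; exact: cvg_cst.
have -> : (fun s => orbit_energy m.+1 (u s)) =
    (fun s => orbit_energy m (u s) + nrm (iter m F (u s)) ^+ 2).
  by apply/funext => s; rewrite /orbit_energy big_ord_recr.
move=> s; apply: cvgD; first exact: IH.
have Fm : bounded_by (f ^+ m) (iter m F).
  by move=> y; exact: bounded_by_iter _ (ltW f0) Ff y.
have fm : 0 < f ^+ m by rewrite exprn_gt0.
exact: (flow_energy_continuous
  (flow_comp (linear_iter m lF) fm Fm (iter_commute m) ux)).
Qed.

Definition lyapunov_rate := 3 * c / (16 * energy_bound).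

Lemma lyapunov_rate_gt0 : 0 < lyapunov_rate.
Proof.
rewrite divr_gt0 ?mulr_gt0//; apply: lt_le_trans energy_bound_ge1.
exact: ltr01.
Qed.

Let lyapunov_rate_le y :
  lyapunov_rate * orbit_energy n y <= 3 * c / 16 * nrm y ^+ 2.
Proof.
have := energy_bound_ge1 => K1; have K0 : 0 < energy_bound.
  by apply: lt_le_trans K1; exact: ltr01.
rewrite /lyapunov_rate invfM mulrA -[X in X <= _]mulrA ler_wpM2l//.
  by rewrite divr_ge0// mulr_ge0// ltW.
by rewrite mulrC ler_pdivrMr// mulrC orbit_energy_le.
Qed.

Let cayley_ge y : c * nrm y <= nrm (A y - (2 * c)%:C *: y).
Proof.
have := nrm_dist ((2 * c)%:C *: y) (A y); rewrite nrm_distC nrmZ cabs_real.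
rewrite ger0_norm; last by rewrite mulr_ge0// ltW.
by have := Ac y; lra.
Qed.

Let cayley_sqr_ge y :
  c ^+ 2 * nrm y ^+ 2 <= nrm (A y - (2 * c)%:C *: y) ^+ 2.
Proof.
by rewrite -exprMn ler_pXn2r ?nnegrE ?mulr_ge0 ?nrm_ge0 ?(ltW c0).
Qed.

(** When [F ^ n] is a contraction along the trajectory, the energy of the
orbit under [F] is a strict Lyapunov function. *)
Lemma lyapunov_decay x u (t : R) : flow A x u -> 0 <= t ->
  (forall s, 0 < s -> let v := A (u s) - (2 * c)%:C *: u s in
    nrm (iter n F v) <= 2^-1 * nrm v) ->
  nrm (u t) ^+ 2 <= energy_bound * nrm x ^+ 2 * expR (- lyapunov_rate * t).
Proof.
move=> ux t0 contr; have [_ u0 _] := ux.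
apply: (le_trans (orbit_energy_ge _)).
have := @gronwall _ (fun s => orbit_energy n (u s))
  (fun s => 2 * rate n (u s)) (- lyapunov_rate) t t0
  (@orbit_energy_continuous n x u ux).
rewrite u0 => gr.
apply: (@le_trans _ _ (orbit_energy n x * expR (- lyapunov_rate * t))).
  apply: gr => s /andP[s0 _]; first exact: orbit_energy_derivative ux s0.
  have := contr _ s0; have := rate_cayley (u s); have := cayley_sqr_ge (u s).
  have := lyapunov_rate_le (u s).
  set v := A (u s) - _; set r := rate _ _; set E := orbit_energy _ _.
  move=> h1 h2 h3 h4.
  have h5 : nrm (iter n F v) ^+ 2 <= 4^-1 * nrm v ^+ 2.
    have -> : (4^-1 : R) = 2^-1 ^+ 2 by rewrite expr2; field.
    by rewrite -exprMn ler_pXn2r ?nnegrE ?nrm_ge0 ?mulr_ge0 ?nrm_ge0.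
  have c4 : 0 < 4 * c by rewrite mulr_gt0.
  rewrite mulNr -(ler_pM2l c4); have := ler_wpM2l (ltW c4) h1.
  by move: h2 h3 h5; rewrite [c ^+ 2]expr2; lra.
by rewrite ler_wpM2r ?expR_ge0// orbit_energy_le.
Qed.

Lemma lyapunov_growth x u (t : R) : flow A x u -> 0 <= t ->
  (forall s, 0 < s -> let v := A (u s) - (2 * c)%:C *: u s in
    2 * nrm v <= nrm (iter n F v)) ->
  nrm x ^+ 2 * expR (lyapunov_rate * t) <= energy_bound * nrm (u t) ^+ 2.
Proof.
move=> ux t0 contr; have [_ u0 _] := ux.
apply: le_trans (orbit_energy_le _).
have := @gronwall _ (fun s => - orbit_energy n (u s))
  (fun s => - (2 * rate n (u s))) lyapunov_rate t t0.
rewrite u0 mulNr lerN2 => gr.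
apply: (@le_trans _ _ (orbit_energy n x * expR (lyapunov_rate * t))).
  by rewrite ler_wpM2r ?expR_ge0// orbit_energy_ge.
apply: gr => [s|s /andP[s0 _]|s /andP[s0 _]].
- by apply: cvgN; exact: (@orbit_energy_continuous n x u ux).
- by apply: is_deriveN; exact: orbit_energy_derivative ux s0.
have := contr _ s0; have := rate_cayley (u s); have := cayley_sqr_ge (u s).
have := lyapunov_rate_le (u s).
set v := A (u s) - _; set r := rate _ _; set E := orbit_energy _ _.
move=> h1 h2 h3 h4.
have h5 : 4 * nrm v ^+ 2 <= nrm (iter n F v) ^+ 2.
  have -> : (4 : R) = 2 ^+ 2 by rewrite expr2 -natrM.
  by rewrite -exprMn ler_pXn2r ?nnegrE ?nrm_ge0 ?mulr_ge0 ?nrm_ge0.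
have c4 : 0 < 4 * c by rewrite mulr_gt0.
rewrite mulrN lerN2 -(ler_pM2l c4); have := ler_wpM2l (ltW c4) h1.
by move: h2 h3 h5; have := sqr_ge0 (nrm v); rewrite [c ^+ 2]expr2; lra.
Qed.

End lyapunov.

(** * From the resolvent to a dichotomy *)

Section resolvent_to_dichotomy.
Context {R : realType} {X : hilbertType R}.
Variables (A : X -> X) (c : R).
Hypotheses (lA : linear A) (c0 : 0 < c) (Ac : bounded_by c A).

(** The imaginary axis, or (for [full]) the closed right half-plane, on which
the resolvent is assumed to exist; the Cayley transform turns it into the unit
circle, or the closed unit disc. *)
Definition region (full : bool) (z : R[i]) : Prop :=
  complex.Re z = 0 \/ full /\ 0 <= complex.Re z.

Definition cayley_region (full : bool) (w : R[i]) : Prop :=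
  cabs w = 1 \/ full /\ cabs w <= 1.

Variable full : bool.
Hypothesis resA : forall z, region full z ->
  boundedly_invertible (fun x => z *: x - A x).

(** Compactness of a box outside of which the Neumann series applies. *)
Lemma uniform_resolvent_bound : exists2 M : R, 0 < M &
  forall z, region full z -> forall x, nrm x <= M * nrm (z *: x - A x).
Proof.
pose K : set (R * R) :=
  `[0, if full then 2 * c else 0]%classic `*` `[- (2 * c), 2 * c]%classic.
pose P (M : R) (p : R * R) :=
  forall x, nrm x <= M * nrm ((p.1 +i* p.2) *: x - A x).
have cK : compact K by apply: compact_setX; exact: segment_compact.
have KP : \forall M \near +oo, K `<=` P M.
  move/compact_near_coveringP: cK; apply=> p Kp.
  have [] := resA (z := p.1 +i* p.2) _.
    case: Kp; rewrite /= !in_itv/= => /andP[p0 pf] _; rewrite /region/=.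
    case: full pf => pf; first by right.
    by left; apply/le_anti; rewrite p0 pf.
  move=> [M0 M00 pM] _.
  have e0 : 0 < (4 * M0)^-1 by rewrite invr_gt0 mulr_gt0.
  exists (ball p (4 * M0)^-1, [set M | 2 * M0 <= M]).
    by split; [exact: nbhsx_ballx | exact: (nbhs_pinfty_ge (num_real _))].
  move=> [q M] /= [[q1 q2] MM x].
  have d : cabs ((p.1 +i* p.2) - (q.1 +i* q.2)) * M0 <= 2^-1.
    have -> : (p.1 +i* p.2) - (q.1 +i* q.2) =
        (p.1 - q.1)%:C + (p.2 - q.2)%:C * 'i.
      by apply/eqP; rewrite eq_complex/=; apply/andP; split; apply/eqP; ring.
    have := cabsD (p.1 - q.1)%:C ((p.2 - q.2)%:C * 'i).
    rewrite cabsM !cabs_real.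
    rewrite cabs_i mulr1 => h; rewrite -ler_pdivlMr//.
    apply: (le_trans h); apply: (@le_trans _ _ ((4 * M0)^-1 + (4 * M0)^-1)).
      by rewrite lerD// ltW.
    by rewrite invfM; have := M00; rewrite -invr_gt0; lra.
  have h1 := pM x.
  have h2 : nrm ((p.1 +i* p.2) *: x - A x) <=
      nrm ((q.1 +i* q.2) *: x - A x) +
      cabs ((p.1 +i* p.2) - (q.1 +i* q.2)) * nrm x.
    have -> : (p.1 +i* p.2) *: x - A x = ((q.1 +i* q.2) *: x - A x) +
        ((p.1 +i* p.2) - (q.1 +i* q.2)) *: x.
      by rewrite scalerBl [RHS]addrC subrKA.
    by rewrite -nrmZ nrmD.
  have h3 := ler_wpM2l (ltW M00) h2.
  have h4 := ler_wpM2r (nrm_ge0 x) d.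
  have h5 := ler_wpM2r (nrm_ge0 ((q.1 +i* q.2) *: x - A x)) MM.
  by move: h1 h3 h4 h5; lra.
near (+oo : set_system R) => M.
have M1 : c^-1 <= M by near: M; exact: (nbhs_pinfty_ge (num_real _)).
have KM : K `<=` P M by near: M; exact: KP.
have Mp : 0 < M by apply: lt_le_trans M1; rewrite invr_gt0.
exists M => // z zr x.
have [zc|zc] := leP (cabs z) (2 * c).
  have -> : z = complex.Re z +i* complex.Im z by case: z {zr zc}.
  apply: (KM (complex.Re z, complex.Im z)); split => /=.
    have := Re_le_cabs z; rewrite ler_norml in_itv/= => /andP[_ h].
    case: zr => [->|[-> z0]]; last by rewrite z0 (le_trans h).
    by rewrite lexx/=; case: ifP => // _; rewrite mulr_ge0// ltW.
  by have := Im_le_cabs z; rewrite in_itv/= -ler_norml => /le_trans; apply.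
have cz : c < cabs z by apply: lt_trans zc; rewrite ltr_pMl// ltr1n.
apply: (le_trans (resolvent_large_bound Ac x cz)).
apply: ler_wpM2r; first exact: nrm_ge0.
apply: le_trans M1; rewrite lef_pV2 ?posrE//; lra.
Unshelve. all: by end_near. Qed.

(** The Moebius map [w |-> a (1 + w) / (1 - w)] sends the unit circle to the
imaginary axis, and the disc to the right half-plane. *)
Lemma region_of_cayley_region (w l : R[i]) (a : R) : 0 < a -> w != 1 ->
  cayley_region full w -> (1 - w) * l = a%:C * (1 + w) -> region full l.
Proof.
case: w l => p q [l m] a0 w1.
have D0 : 0 < (1 - p) ^+ 2 + q ^+ 2.
  rewrite lt_neqAle eq_sym addr_ge0 ?sqr_ge0// andbT.
  apply: contra w1; rewrite paddr_eq0 ?sqr_ge0// !sqrf_eq0 subr_eq0.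
  by move=> /andP[/eqP <- /eqP ->].
move=> wr /eqP; rewrite eq_complex/= => /andP[/eqP e1 /eqP e2].
have e : l * ((1 - p) ^+ 2 + q ^+ 2) = a * (1 - (p ^+ 2 + q ^+ 2)).
  have -> : l * ((1 - p) ^+ 2 + q ^+ 2) =
    (1 - p) * ((1 - p) * l - (0 - q) * m) +
    (0 - q) * ((1 - p) * m + (0 - q) * l).
    by ring.
  have -> : (1 - p) * l - (0 - q) * m = a * (1 + p) - 0 * (0 + q) by exact: e1.
  have -> : (1 - p) * m + (0 - q) * l = a * (0 + q) + 0 * (1 + p) by exact: e2.
  by ring.
rewrite /region/=; case: wr => [w1'|[ff w1']].
  left; have := cabs_sqr (p +i* q); rewrite w1' expr1n /= => h.
  apply/eqP; rewrite -(mulIr_eq0 _ (mulIf (lt0r_neq0 D0))) e -h.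
  by rewrite subrr mulr0.
right; split=> //.
have : cabs (p +i* q) ^+ 2 <= 1 by rewrite exprn_ile1 ?cabs_ge0.
rewrite cabs_sqr/= => h; rewrite -(pmulr_lge0 _ D0) e.
by rewrite (mulr_ge0 (ltW a0))// subr_ge0.
Qed.

(** For [F = (A + a) (A - a)^-1] with [a = 2 c], one has
[1 - w F = (1 - w) (l - A) (a - A)^-1], where [l] is the Moebius image of [w].
The bound on the resolvent of [A] makes the inverse uniformly bounded, except
near [w = 1], where [l] escapes to infinity and [|A| < a] is used instead. *)
Lemma cayley_transform : exists (F : X -> X) (f M : R) (h : R[i] -> X -> X),
  [/\ linear F, 0 < f, bounded_by f F, 0 < M &
   [/\ (forall x, F (A x) = A (F x)),
       (forall y, F (A y - (2 * c)%:C *: y) = A y + (2 * c)%:C *: y),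
       (forall w, cayley_region full w ->
         inverse_of (fun x => x - w *: F x) (h w)) &
       forall w, cayley_region full w -> bounded_by M (h w)]].
Proof.
have a0 : 0 < 2 * c by rewrite mulr_gt0.
pose a : R[i] := (2 * c)%:C.
have ca : c < cabs a by rewrite cabs_real gtr0_norm// ltr_pMl// ltr1n.
have lres := linear_resolvent lA a.
have [g [gK Kg lg [m m0 gm]]] :=
  boundedly_invertibleP lres (resolvent_large lA (ltW c0) Ac ca).
pose F x := x - (2%:R * a) *: g x.
have FE y : F (a *: y - A y) = - (a *: y + A y).
  rewrite /F gK -scalerA scaler_nat mulr2n opprD addrACA.
  by rewrite subrr add0r [RHS]opprD [RHS]addrC.
have lF : linear F.
  move=> b x y; rewrite /F lg scalerDr opprD addrACA scalerBr !scalerA.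
  by rewrite (mulrC b).
have gA x : g (A x) = A (g x).
  have -> : A x = a *: A (g x) - A (A (g x)).
    by rewrite -(linZ lA) -(linB lA) Kg.
  by rewrite gK.
have [M M0 bM] := uniform_resolvent_bound.
pose M' := 2 + 8 * c * M.
have M'0 : 0 < M' by rewrite ltr_wpDr// !mulr_ge0// ltW.
have wE w y : (a *: y - A y) - w *: F (a *: y - A y) =
    ((1 + w) * a) *: y - (1 - w) *: A y.
  rewrite FE scalerN opprK scalerDr addrACA scalerA -scalerDl.
  congr (_ + _); first by rewrite mulrDl mul1r.
  by rewrite scalerBl scale1r opprB addrC.
pose mu w := (1 - w)^-1 * ((1 + w) * a).
have wE1 w y : w != 1 -> (a *: y - A y) - w *: F (a *: y - A y) =
    (1 - w) *: (mu w *: y - A y).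
  move=> w1; rewrite wE scalerBr scalerA mulrA divff ?mul1r//.
  by rewrite subr_eq0 eq_sym.
have mur w : w != 1 -> cayley_region full w -> region full (mu w).
  move=> w1 wr; apply: (region_of_cayley_region a0 w1 wr).
  by rewrite /mu mulrA divff ?mul1r 1?mulrC// subr_eq0 eq_sym.
have lfw w : linear (fun x => x - w *: F x) by exact: linear_sub_scale.
have xg x : x = a *: g x - A (g x) by rewrite Kg.
have cabs_a : cabs a = 2 * c by rewrite cabs_real gtr0_norm.
have xle x : nrm x <= 3 * c * nrm (g x).
  rewrite {1}(xg x); have := nrmB (a *: g x) (A (g x)).
  by rewrite nrmZ cabs_a; have := Ac (g x); lra.
have low w x : cayley_region full w -> nrm x <= M' * nrm (x - w *: F x).
  have fE : x - w *: F x =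
      (a *: g x - A (g x)) - w *: F (a *: g x - A (g x)) by rewrite -(xg x).
  move=> wr; have := xle x; rewrite fE; set y := g x => xy.
  have y0 := nrm_ge0 y.
  have [w2|w2] := leP (cabs (1 - w)) 2^-1.
    rewrite wE; set z := nrm (_ - _).
    have h1 : nrm (((1 + w) * a) *: y) - nrm ((1 - w) *: A y) <= z.
      exact: nrm_dist.
    rewrite !nrmZ cabsM cabs_a in h1.
    have h2 : 3 / 2 <= cabs (1 + w).
      have := cabsD (1 + w) (1 - w); rewrite addrACA subrr addr0.
      by rewrite -mulr2n cabs_nat; lra.
    have h3 := ler_wpM2r (mulr_ge0 (ltW a0) y0) h2.
    have h4 : cabs (1 - w) * nrm (A y) <= 2^-1 * (c * nrm y).
      by apply: ler_pM; rewrite ?cabs_ge0 ?nrm_ge0.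
    have h5 : 0 <= 8 * c * M * z by rewrite !mulr_ge0 ?nrm_ge0// ltW.
    have z0 : 0 <= z by exact: nrm_ge0.
    by rewrite /M'; move: h1 h3 h4 h5; have := mulr_ge0 (ltW c0) y0; lra.
  have w1 : w != 1.
    by apply/eqP => w1; move: w2; rewrite w1 subrr cabs0 ltNge invr_ge0 ler0n.
  rewrite wE1// nrmZ; set z := mu w *: y - A y.
  have h1 : nrm y <= M * nrm z by exact: (bM _ (mur _ w1 wr)).
  have z0 : 0 <= nrm z by exact: nrm_ge0.
  have h2 := ler_wpM2r z0 (ltW w2).
  have cM : 0 <= 8 * c * M by rewrite !mulr_ge0// ltW.
  have h3 := ler_wpM2l cM h2.
  have h4 := ler_wpM2l (ltW c0) h1.
  have h5 := mulr_ge0 (cabs_ge0 (1 - w)) z0.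
  have h6 := mulr_ge0 (mulr_ge0 (ltW c0) (ltW M0)) z0.
  by rewrite /M'; move: h3 h4 h5 h6; lra.
have surj w z : cayley_region full w -> exists x, x - w *: F x = z.
  move=> wr; have [w1|w1] := eqVneq w 1.
    exists (a *: (((1 + w) * a)^-1 *: z) - A (((1 + w) * a)^-1 *: z)).
    rewrite wE w1 subrr scale0r subr0 scalerA divff ?scale1r//.
    by rewrite mulf_eq0 negb_or -mulr2n pnatr_eq0/= -cabs_eq0 cabs_a gt_eqF.
  have [_ /(_ ((1 - w)^-1 *: z))[y yz]] := resA (mur w w1 wr).
  exists (a *: y - A y); rewrite wE1// yz scalerA divff ?scale1r//.
  by rewrite subr_eq0 eq_sym.
have /choice[h hP] w : exists h : X -> X, cayley_region full w ->
    inverse_of (fun x => x - w *: F x) h /\ bounded_by M' h.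
  have [wr|nwr] := pselect (cayley_region full w); last by exists id.
  have [|h [hK Kh _ _]] := boundedly_invertibleP (lfw w).
    by split; [exists M' => // x; exact: low | move=> z; exact: surj].
  by exists h => _; split=> // z; rewrite (le_trans (low w (h z) wr))// Kh.
exists F, (1 + 4 * c * m), M', h; split=> //.
- by rewrite ltr_pwDl// !mulr_ge0// ltW.
- move=> x; rewrite /F (le_trans (nrmB _ _))//.
  rewrite [(1 + 4 * c * m) * _]mulrDl mul1r lerD2l nrmZ cabsM.
  rewrite cabs_nat.
  by rewrite cabs_a; have := ler_wpM2l (ltW c0) (gm x); lra.
split=> [x|y|w /hP[]|w /hP[]]//.
  by rewrite /F gA (linB lA) (linZ lA).
have -> : A y - a *: y = - (a *: y - A y) by rewrite opprB.
by rewrite (linN lF) FE opprK addrC.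
Qed.

(** The spectral projection of the Cayley transform splits the space into parts on
which a power of the transform contracts, respectively expands, and there the
Lyapunov estimates apply. *)
Theorem exponential_dichotomy : exists (P : X -> X) (rho K : R),
  [/\ linear P, exists2 C : R, 0 < C & bounded_by C P,
      forall x, P (P x) = P x, forall x, P (A x) = A (P x) &
      full -> forall x, P x = x] /\
  [/\ 0 < rho, 0 < K &
   forall x u (t : R), flow A x u -> 0 <= t ->
     (P x = x -> nrm (u t) <= K * expR (- rho * t) * nrm x) /\
     (P x = 0 -> K^-1 * expR (rho * t) * nrm x <= nrm (u t))].
Proof.
have [F [f [M [h [lF f0 Ff M0 [FA Fc hF hM]]]]]] := cayley_transform.
have circ w : circle w -> cayley_region full w by left.
have [P [[k [k0 Pk]] lP [C C0 PC] PP Pcomm]] :=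
  circle_mean_exists lF (ltW f0) Ff (ltW M0)
    (fun w w1 => hF w (circ w w1)) (fun w w1 => hM w (circ w w1)).
have PA x : P (A x) = A (P x).
  by symmetry; rewrite -(Pcomm _ _ lA (ltW c0) Ac).
have PF x : P (F x) = F (P x) by rewrite (Pcomm _ _ lF (ltW f0) Ff).
have [j kj] : exists j, k * (5 / 7) ^+ j <= 3^-1.
  have /cvgrPdist_lt/(_ _ (_ : 0 < 3^-1)) := cvg_57 k.
  rewrite invr_gt0 ltr0n => /(_ isT)[j _ /(_ j (leqnn j))].
  rewrite sub0r normrN => h1; exists j; apply: ltW.
  exact: le_lt_trans (ler_norm _) h1.
pose n := (2 ^ j)%N; have n0 : (0 < n)%N by rewrite expn_gt0.
(* [P] is close to the inverse of [1 - F ^ n]: this makes [F ^ n] small on the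
   range of [P] and large on its kernel. *)
have near_inverse v : nrm (P (v - iter n F v) - v) <=
    3^-1 * (nrm v + nrm (iter n F v)).
  have [GK _] :=
    root_average_inverse lF (fun w w1 => hF w (circ w w1)) j circle1.
  have := Pk j (v - iter n F v); have := GK v; rewrite /= scale1r => ->.
  move/le_trans; apply; apply: (@le_trans _ _ (3^-1 * nrm (v - iter n F v))).
    by rewrite ler_wpM2r ?nrm_ge0.
  by rewrite ler_wpM2l ?nrmB// invr_ge0.
have PFn v : P (iter n F v) = iter n F (P v).
  by elim: n {n0 near_inverse} => //= m IH; rewrite PF IH.
have contr v : P v = v -> nrm (iter n F v) <= 2^-1 * nrm v.
  move=> Pv; have := near_inverse v; rewrite (linB lP) PFn Pv.
  by rewrite addrAC subrr add0r nrmN; lra.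
have expand v : P v = 0 -> 2 * nrm v <= nrm (iter n F v).
  move=> Pv; have := near_inverse v; rewrite (linB lP) PFn Pv.
  by rewrite (lin0 (linear_iter n lF)) subr0 add0r nrmN; lra.
pose v0 (u : R -> X) s := A (u s) - (2 * c)%:C *: u s.
have Pv0 u s y : P (u s) = y -> P (v0 u s) = A y - (2 * c)%:C *: y.
  by move=> Py; rewrite /v0 (linB lP) (linZ lP) PA Py.
pose K := energy_bound f n; have K1 : 1 <= K by exact: energy_bound_ge1.
have K0 : 0 < K by apply: lt_le_trans K1.
pose rho := lyapunov_rate c f n / 2.
have r2 : lyapunov_rate c f n = rho + rho by rewrite /rho; lra.
exists P, rho, K; split; split=> //.
- by exists C.
- move=> ff; apply: (circle_mean_disc lF (ltW f0) Ff (ltW M0) _ _ (h := h)).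
  + by move=> w w1; apply: hF; right.
  + by move=> w w1; apply: hM; right.
  + by exists k; split=> // i x; exact: Pk.
- by rewrite divr_gt0// lyapunov_rate_gt0.
move=> x u t ux t0; have [_ u0 _] := ux; split=> Px.
  have Pu s : 0 < s -> P (u s) = u s.
    move=> s0; have Pux := flow_comp lP C0 PC PA ux; rewrite Px in Pux.
    exact: (flow_unique lA (ltW c0) Ac Pux ux (ltW s0)).
  have := lyapunov_decay c0 Ac lF f0 Ff FA Fc n0 ux t0.
  rewrite -/K r2 => /(_ _)/le_trans H.
  rewrite -(ler_pXn2r (_ : (0 < 2)%N))// ?nnegrE ?nrm_ge0//; last first.
    by rewrite !mulr_ge0 ?expR_ge0 ?nrm_ge0// ltW.
  apply: H => [s s0|]; first by apply: contr; rewrite (Pv0 u s (u s)) ?Pu.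
  rewrite mulNr mulrDl opprD expRD -mulNr !exprMn mulrAC.
  rewrite -[expR _ * expR _]expr2 ler_wpM2r ?sqr_ge0// ler_wpM2r ?sqr_ge0//.
  by rewrite expr2 ler_peMl// ltW.
have Pu s : 0 < s -> P (u s) = 0.
  move=> s0; have Pux := flow_comp lP C0 PC PA ux; rewrite Px in Pux.
  have := flow_lin (-1) lA Pux Pux; rewrite scaler0 addr0 => Pux0.
  rewrite -[LHS]/((P \o u) s) (flow_unique lA (ltW c0) Ac Pux Pux0 (ltW s0)).
  by rewrite /= scaleN1r addNr.
have := lyapunov_growth c0 Ac lF f0 Ff FA Fc n0 ux t0.
rewrite -/K r2 => H.
rewrite -(ler_pXn2r (_ : (0 < 2)%N))// ?nnegrE ?nrm_ge0//; last first.
  by rewrite !mulr_ge0 ?expR_ge0 ?nrm_ge0// invr_ge0 ltW.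
have {}H : nrm x ^+ 2 * expR ((rho + rho) * t) <= K * nrm (u t) ^+ 2.
  apply: H => s s0; apply: expand; rewrite (Pv0 u s 0) ?Pu//.
  by rewrite (lin0 lA) scaler0 subr0.
rewrite !exprMn -mulrA exprVn mulrC ler_pdivrMr ?exprn_gt0//.
rewrite [expR _ ^+ 2]expr2 -expRD -mulrDl mulrC; apply: (le_trans H).
by rewrite [leRHS]mulrC ler_wpM2r ?sqr_ge0// expr2 ler_peMl// ltW.
Qed.

End resolvent_to_dichotomy.

(** * Uniform boundedness *)

Section uniform_boundedness.
Context {R : realType} {Y : completeNormedModType R[i]}.
Context {Z : normedModType R[i]}.

(** A vector on which [f] nearly attains its norm, together with a bound
nearly equal to that norm; it spares a definition of the operator norm. *)
Lemma nearly_norming (f : Y -> Z) (K : R) : 0 < K ->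
  (exists c, bounded_by c f) -> ~ bounded_by K f ->
  exists c y, [/\ K <= c, bounded_by c f & 2 / 3 * c * nrm y < nrm (f y)].
Proof.
move=> K0 [c fc] nK.
have mono (a b : R) : a <= b -> bounded_by a f -> bounded_by b f.
  by move=> ab fa y; rewrite (le_trans (fa y))// ler_wpM2r// nrm_ge0.
have cK : K < c.
  by rewrite ltNge; apply/negP => cK; apply: nK; exact: mono fc.
pose d m : R := c * (2 / 3) ^+ m.
have [m dm] : exists m, ~ bounded_by (d m) f.
  have : d m @[m --> \oo] --> (0 : R).
    rewrite -[X in _ --> X](mulr0 c); apply: cvgM; first exact: cvg_cst.
    by apply: cvg_expr; rewrite ger0_norm; lra.
  move=> /cvgrPdist_lt/(_ _ K0)[m _ /(_ m (leqnn m))].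
  rewrite sub0r normrN => h; exists m => fm; apply: nK; apply: mono fm.
  by apply/ltW; apply: le_lt_trans h; exact: ler_norm.
elim: m dm => [|m IH] dm; first by exfalso; apply: dm; rewrite /d expr0 mulr1.
have [fm|] := pselect (bounded_by (d m) f); last exact: IH.
exists (d m).
have /existsNP[y /negP] := dm; rewrite -ltNge => hy.
exists y; split=> //.
  rewrite leNgt; apply/negP => /ltW dK; apply: nK; exact: mono dK fm.
by move: hy; rewrite /d exprS (mulrCA c).
Qed.

(** Uniform boundedness by a gliding hump: the signs of the steps are chosen
so that the [k]-th operator is large at the [k]-th point, and the later steps
are too small to undo this. *)
Theorem uniform_boundedness (T : nat -> Y -> Z) :
  (forall n, linear (T n)) -> (forall n, exists c, bounded_by c (T n)) ->
  (forall y, exists K, forall n, nrm (T n y) <= K) ->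
  exists2 K : R, 0 < K & forall n, bounded_by K (T n).
Proof.
move=> lT bT pT; apply: contrapT => nK.
pose K (k : nat) : R := k.+1%:R * 3 ^+ k.
have K0 k : 0 < K k by rewrite mulr_gt0// exprn_gt0.
have H k : exists p : nat * R * Y, [/\ K k <= p.1.2,
    bounded_by p.1.2 (T p.1.1) & 2 / 3 * p.1.2 * nrm p.2 < nrm (T p.1.1 p.2)].
  have /existsNP[n Tn] : ~ forall n, bounded_by (K k) (T n).
    by move=> hk; apply: nK; exists (K k).
  have [c [y [h1 h2 h3]]] := nearly_norming (K0 k) (bT n) Tn.
  by exists (n, c, y).
have {H}[p pP] := choice H.
pose n k := (p k).1.1; pose c k := (p k).1.2; pose y k := (p k).2.
have y0 k : 0 < nrm (y k).
  have [_ _ h] := pP k; rewrite lt_neqAle nrm_ge0 andbT eq_sym.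
  apply: contraTneq h => e.
  by rewrite -/(y k) (nrm0_eq0 e) (lin0 (lT _)) !nrm0 mulr0 ltxx.
pose d k : Y := ((1 / 3) ^+ k / nrm (y k))%:C *: y k.
have q0 k : 0 <= (1 / 3 : R) ^+ k by rewrite exprn_ge0// divr_ge0.
have dE k : nrm (d k) = (1 / 3) ^+ k.
  rewrite nrmZ cabs_real ger0_norm ?divr_ge0 ?nrm_ge0//.
  by rewrite divfK// gt_eqF.
have Td k : 2 / 3 * c k * (1 / 3) ^+ k <= nrm (T (n k) (d k)).
  have [_ _ /ltW h] := pP k.
  rewrite (linZ (lT _)) nrmZ cabs_real ger0_norm ?divr_ge0 ?nrm_ge0//.
  rewrite [leRHS]mulrAC ler_pdivlMr//.
  by move: (ler_wpM2l (q0 k) h); rewrite -/(y k) -/(n k) -/(c k); lra.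
pose step k (x : Y) : Y :=
  if nrm (T (n k) (d k)) <= nrm (T (n k) (x + d k)) then x + d k else x - d k.
pose x := fix x k := if k is j.+1 then step j (x j) else 0.
have xS k : x k.+1 = step k (x k) by [].
have stepd k v : nrm (step k v - v) = (1 / 3) ^+ k.
  rewrite /step; case: ifP => _; first by rewrite addrC addKr dE.
  by rewrite addrC addKr nrmN dE.
have stepT k v : nrm (T (n k) (d k)) <= nrm (T (n k) (step k v)).
  rewrite /step; case: ifPn => //; rewrite -ltNge => h.
  have := nrmB (T (n k) (v + d k)) (T (n k) (v - d k)).
  have e : v + d k - (v - d k) = 2%:R *: d k.
    by rewrite opprB [v + _]addrC addrACA subrr addr0 scaler_nat mulr2n.
  rewrite -(linB (lT _)) e (linZ (lT _)) nrmZ.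
  rewrite cabs_nat.
  by move: h; lra.
have [l lx] : exists l, forall k,
    nrm (l - x k) <= 1 / (1 - 1 / 3) * (1 / 3) ^+ k.
  apply: nrm_geometric_cvg => [|k]; first by lra.
  by rewrite [leRHS]mul1r xS stepd.
have [B lB] := pT l.
have hB k : k.+1%:R <= 6 * B.
  have [h1 h2 _] := pP k; rewrite -/(n k) -/(c k) in h1 h2.
  have e32 : 1 / (1 - 1 / 3) = 3 / 2 :> R by field.
  have h3 := lx k.+1; rewrite exprS e32 in h3.
  have h4 := h2 (x k.+1 - l); rewrite (linB (lT _)) nrm_distC in h4.
  have h5 := nrm_dist (T (n k) (x k.+1)) (T (n k) l).
  have h6 := stepT k (x k); rewrite -xS in h6.
  have h7 := Td k; have h8 := lB (n k).
  have ck : 0 <= c k by apply: le_trans h1; exact/ltW/K0.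
  rewrite nrm_distC in h3; have h9 := ler_wpM2l ck h3.
  rewrite nrm_distC in h5.
  have h10 := ler_wpM2r (q0 k) h1; move: h10.
  have -> : K k * (1 / 3) ^+ k = k.+1%:R.
    by rewrite /K -mulrA -exprMn mul1r divff ?expr1n ?mulr1// pnatr_eq0.
  by move: h4 h5 h6 h7 h8 h9; lra.
have := hB (Num.truncn (6 * B)); rewrite leNgt => /negP; apply.
exact: truncnS_gt.
Qed.

End uniform_boundedness.

(** * Reduction of a regular pencil to a bounded operator on IV *)

Lemma boundedOp_linear (R : realType) (X Y : normedModType R[i])
  (f : boundedOp X Y) : linear f.
Proof. by move=> a x y; exact: linearP. Qed.

(** On [S], the vector [y] itself has the property that defines the adjoint, and
positive definiteness makes it the only one. *)
Lemma iota_starE (R : realType) (H : hilbertType R) (S : closedSubspace H) y :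
  carrier S y -> Defs.iota (iota_star S y) = y.
Proof.
move=> Sy; pose y' : subspace_type S := Subspace (mem_set Sy).
suff -> : iota_star S y = y' by [].
apply: xget_unique => [x//|z zP].
have := zP (y' - z); rewrite -[inner (Defs.iota _) y]/(inner (y' - z) y').
move=> e; apply/eqP; rewrite eq_sym -subr_eq0; apply/eqP/nrm0_eq0/eqP.
rewrite -sqrf_eq0 -rdotxx rdotDr rdotNr /rdot e.
by rewrite subrr.
Qed.

Section regular_pencil.
Context {R : realType} {H : hilbertType R}.
Variables (M0 M1 : boundedOp H H) (clM0 : closed (range M0)).
Hypothesis reg : regular M0 M1.

Let lM0 : linear M0. Proof. exact: boundedOp_linear. Qed.
Let lM1 : linear M1. Proof. exact: boundedOp_linear. Qed.

Let pencil_inverses : exists (b : R) (zeta : nat -> R) (N : nat -> H -> H),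
  [/\ 0 < b, forall n, n.+1%:R <= zeta n, forall n, linear (N n) &
   [/\ forall n x, N n ((zeta n)%:C *: M0 x + M1 x) = x,
       forall n x, (zeta n)%:C *: M0 (N n x) + M1 (N n x) = x &
       forall n, bounded_by b (N n)]].
Proof.
have [nu [c regc]] := reg.
pose zeta (n : nat) : R := `|nu| + n.+1%:R.
have nuz n : nu < complex.Re (zeta n)%:C.
  by apply: (le_lt_trans (ler_norm _)); rewrite /= /zeta ltrDl ltr0n.
have /choice[N NP] n := regc _ (nuz n).
exists (`|c| + 1), zeta, (fun n => N n : H -> H); split.
- by rewrite ltr_wpDl.
- by move=> n; rewrite /zeta lerDr.
- by move=> n; exact: boundedOp_linear.
split=> n x; have [h1 h2 h3] := NP n.
- exact: h1.
- exact: h2.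
have := h3 x; rewrite !nrmE -rmorphM lecR => /le_trans; apply.
by rewrite ler_wpM2r ?nrm_ge0// ler_wpDr// ler_norm.
Qed.

(** Closedness of the range enters here: the operators [z N], with
[N = (z M0 + M1)^-1], are bounded on every vector of the range of [M0], hence
uniformly bounded on the range. In [x = z N (M0 x) + N (M1 x)] the last term is
therefore [O (|x| / z)] for [x] in IV, and is absorbed for one large [z]. *)
Lemma IV_coercive :
  exists2 D : R, 0 < D & forall x, IV_set M0 M1 x -> nrm x <= D * nrm (M0 x).
Proof.
have [b [zeta [N [b0 zn lN [NK KN Nb]]]]] := pencil_inverses.
have z0 n : 0 < zeta n by apply: lt_le_trans (zn n); rewrite ltr0n.
have [m1 m10 M1b] := boundedOp_bounded M1.
pose Y := subspace_type (range_subspace M0 clM0).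
pose T n (r : Y) : H := (zeta n)%:C *: N n (Defs.iota r).
have TM0 n y : (zeta n)%:C *: N n (M0 y) = y - N n (M1 y).
  by rewrite -(linZ (lN n)) -{2}(NK n y) (linD (lN n)) addrK.
have [||r|K K0 TK] := @uniform_boundedness _ Y H T.
- move=> n a x y; rewrite /T -[Defs.iota _]/(a *: Defs.iota x + Defs.iota y).
  by rewrite lN scalerDr !scalerA mulrC.
- move=> n; exists (zeta n * b) => r; rewrite nrmZ cabs_real gtr0_norm//.
  by rewrite -mulrA ler_wpM2l ?(ltW (z0 n))//; exact: Nb.
- have [y _ yr] : range M0 (Defs.iota r) by exact/set_mem/(valP r).
  exists (nrm y + b * nrm (M1 y)) => n; rewrite /T -yr TM0.
  by rewrite (le_trans (nrmB _ _))// lerD2l Nb.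
pose n := Num.truncn (2 * K * m1).
have zK : 2 * K * m1 < zeta n by apply: lt_le_trans (zn n); exact: truncnS_gt.
exists (2 * b * zeta n) => [|x]; first by rewrite !mulr_gt0.
move=> IVx.
pose r : Y := Subspace (mem_set (IVx : carrier (range_subspace M0 clM0) _)).
have h1 := TK n r; rewrite /T nrmZ cabs_real gtr0_norm// in h1.
have h2 : nrm (N n (M1 x)) * zeta n <= K * (m1 * nrm x).
  by rewrite mulrC (le_trans h1)// ler_wpM2l ?(ltW K0)//; exact: M1b.
have h3 : nrm x <= zeta n * (b * nrm (M0 x)) + nrm (N n (M1 x)).
  rewrite -{1}(NK n x) (linD (lN n)) (linZ (lN n)).
  rewrite (le_trans (nrmD _ _))// lerD2r nrmZ cabs_real gtr0_norm//.
  by rewrite ler_wpM2l ?(ltW (z0 n))//; exact: Nb.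
have h4 : nrm (N n (M1 x)) <= 2^-1 * nrm x.
  rewrite -(ler_pM2r (z0 n)) (le_trans h2)//.
  by have := ler_wpM2r (nrm_ge0 x) (ltW zK); lra.
by move: h3 h4; lra.
Qed.

(** The vectors [z N (M0 w)] lie in IV and their images under [M0] tend to [M0 w];
coercivity makes them converge. *)
Lemma IV_surjective w : exists2 x, IV_set M0 M1 x & M0 x = M0 w.
Proof.
have [b [zeta [N [b0 zn lN [NK KN Nb]]]]] := pencil_inverses.
have z0 n : 0 < zeta n by apply: lt_le_trans (zn n); rewrite ltr0n.
have [m1 m10 M1b] := boundedOp_bounded M1.
have [m0 m00 M0b] := boundedOp_bounded M0.
have [D D0 DIV] := IV_coercive.
pose x n := w - N n (M1 w).
have M0N n v : (zeta n)%:C *: M0 (N n v) = v - M1 (N n v).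
  by rewrite -{2}(KN n v) addrK.
have xE n : x n = (zeta n)%:C *: N n (M0 w).
  by rewrite /x -(linZ (lN n)) -{1}(NK n w) (linD (lN n)) addrK.
have xIV n : IV_set M0 M1 (x n).
  exists ((zeta n)%:C *: (w - (zeta n)%:C *: N n (M0 w))) => //.
  rewrite xE (linZ lM0) (linZ lM1) (linB lM0) (linZ lM0) M0N.
  by rewrite opprB addrC subrK.
pose e : R := nrm (M1 w) + m1 * (b * nrm (M1 w)).
have e0 : 0 <= e by rewrite !(addr_ge0, mulr_ge0) ?nrm_ge0// ltW.
have xM0 n : nrm (M0 (x n) - M0 w) <= e * harmonic n.
  rewrite -(linB lM0) /x addrAC subrr add0r (linN lM0) nrmN.
  rewrite -(ler_pM2l (z0 n)).
  have := M0N n (M1 w) => /(congr1 (@nrm R H)).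
  rewrite nrmZ cabs_real gtr0_norm// => ->.
  apply: (@le_trans _ _ e).
    rewrite (le_trans (nrmB _ _))// lerD2l (le_trans (M1b _))//.
    by rewrite ler_wpM2l ?(ltW m10)//; exact: Nb.
  rewrite mulrCA ler_peMr//.
  by rewrite /harmonic/= ler_pdivlMr ?ltr0n// mul1r zn.
have xc n m : (n <= m)%N -> nrm (x m - x n) <= 2 * D * e * harmonic n.
  move=> nm; have IVd : IV_set M0 M1 (x m - x n).
    by rewrite addrC -scaleN1r; apply: IVP.
  rewrite (le_trans (DIV _ IVd))//.
  have hm : harmonic m <= harmonic n :> R.
    by rewrite /harmonic/= lef_pV2 ?posrE ?ltr0n// ler_nat.
  have := nrmB (M0 (x m) - M0 w) (M0 (x n) - M0 w).
  rewrite opprB addrA subrK -(linB lM0).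
  have := xM0 n; have := xM0 m; have := ler_wpM2l e0 hm => h1 h2 h3 h4.
  have : nrm (M0 (x m - x n)) <= 2 * e * harmonic n by move: h1 h2 h3 h4; lra.
  by move=> /(ler_wpM2l (ltW D0)); lra.
have hc (B : R) : B * harmonic n @[n --> \oo] --> (0 : R).
  rewrite -[X in _ --> X](mulr0 B); apply: cvgM; first exact: cvg_cst.
  exact: cvg_harmonic.
have [l lx] := nrm_cauchy_cvg (hc _) xc; exists l.
  apply: (nrm_closed (IV_closed M0 M1 clM0)) => d d0.
  have /cvgrPdist_lt/(_ _ d0)[n _ /(_ n (leqnn n))] := hc (2 * D * e).
  rewrite sub0r normrN => h; exists (x n) => //.
  by apply: (le_lt_trans (lx n)); apply: le_lt_trans h; exact: ler_norm.
apply/eqP; rewrite -subr_eq0; apply/eqP.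
apply: (@nrm_squeeze _ _ _ (m0 * (2 * D * e) + e) (fun n => harmonic n)).
  exact: cvg_harmonic.
move=> n; rewrite -(subrKA (M0 (x n))) -(linB lM0) (le_trans (nrmD _ _))//.
by rewrite mulrDl lerD// (le_trans (M0b _))// -mulrA (ler_wpM2l (ltW m00)) ?lx.
Qed.

Let X := subspace_type (IV M0 M1 clM0).
Let A : X -> X := IV_operator M0 M1 clM0.

Lemma iota_IV (x : X) : IV_set M0 M1 (Defs.iota x).
Proof. exact/set_mem/(valP x). Qed.

Lemma IV_injective (x y : X) : M0 (Defs.iota x) = M0 (Defs.iota y) -> x = y.
Proof.
move=> xy; have [D _ DIV] := IV_coercive.
apply/eqP; rewrite -subr_eq0; apply/eqP/nrm_le0_eq0.
rewrite (le_trans (DIV _ (iota_IV (x - y))))//.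
rewrite -[Defs.iota (x - y)]/(Defs.iota x - Defs.iota y) (linB lM0).
by rewrite xy subrr nrm0 mulr0.
Qed.

(** The defining relation of the operator on IV: its pseudo-inverse is a genuine
inverse because [M0] maps IV bijectively onto its range. *)
Lemma IV_operatorE (x : X) : M0 (Defs.iota (A x)) = - M1 (Defs.iota x).
Proof.
rewrite /A /IV_operator.
set f := compression _ _ M0; set y := compression _ _ _ _.
have yE : Defs.iota y = M1 (Defs.iota x) by apply: iota_starE; exact: iota_IV.
have [w _ wE] := iota_IV x.
have [v vIV vw] := IV_surjective w.
have fE (z : X) : Defs.iota (f z) = M0 (Defs.iota z).
  by apply: iota_starE; exists (Defs.iota z).
have fy : (f @` setT) y.
  exists (Subspace (mem_set (vIV : carrier (IV M0 M1 clM0) v))) => //.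
  by apply: val_inj; rewrite /= fE yE /= vw wE.
have fK : {in f @` setT, cancel ('pinv_(fun=> 0) setT f) f} by exact: pinvK.
have := fK _ (mem_set fy) => /(congr1 (@Defs.iota _ _ _)).
rewrite fE yE => <-.
by rewrite -[Defs.iota (- _)]/(- Defs.iota _) (linN lM0).
Qed.

Lemma linear_IV_operator : linear A.
Proof.
move=> a x y; apply: IV_injective.
rewrite IV_operatorE -![Defs.iota (_ + _)]/(_ *: Defs.iota _ + Defs.iota _).
by rewrite lM0 lM1 !IV_operatorE opprD scalerN.
Qed.

Lemma bounded_IV_operator : exists2 c : R, 0 < c & bounded_by c A.
Proof.
have [D D0 DIV] := IV_coercive; have [m1 m10 M1b] := boundedOp_bounded M1.
exists (D * m1) => [|x]; first exact: mulr_gt0.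
rewrite (le_trans (DIV _ (iota_IV _)))// IV_operatorE nrmN -mulrA.
by rewrite ler_wpM2l ?(ltW D0)//; exact: M1b.
Qed.

Lemma flow_strong_solution (x : X) (v : R -> X) : flow A x v ->
  strong_solution M0 M1 (Defs.iota x) (fun t => Defs.iota (v t)).
Proof.
have [c c0 Ac] := bounded_IV_operator; have lA := linear_IV_operator.
have ci : continuous (@Defs.iota _ _ (IV M0 M1 clM0)).
  exact: boundedOp_continuous.
move=> [cv v0 dv]; split=> [s||]; last 2 first.
- by rewrite v0.
- exists (fun t => Defs.iota (A (v t))) => t t0; split.
  + apply: (@time_derivative_comp _ _ _
      (@Defs.iota _ _ (IV M0 M1 clM0)) 1) => //.
      by move=> y; rewrite mul1r.
    exact: dv.
  + have /continuous_within_itvcyP[cv' _] := cv.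
    have cvt : {for t, continuous v}.
      by apply: cv'; rewrite in_itv/= t0.
    apply: continuous_comp; last exact: ci.
    by apply: continuous_comp cvt _; exact: (bounded_continuous lA c0 Ac).
  + by rewrite IV_operatorE addNr.
by apply: continuous_comp (cv s) _; exact: ci.
Qed.

(** A strong solution stays in the closed space IV, and so does its derivative,
which is then determined by the injectivity of [M0] on IV. *)
Lemma strong_solution_flow u0 u : IV_set M0 M1 u0 ->
  strong_solution M0 M1 u0 u -> exists (x : X) (v : R -> X),
  [/\ Defs.iota x = u0, flow A x v & forall t, 0 <= t -> Defs.iota (v t) = u t].
Proof.
move=> IVu0 [cu u00 [du duP]].
have IVu t : 0 <= t -> IV_set M0 M1 (u t).
  rewrite le_eqVlt => /orP[/eqP <-|t0]; first by rewrite u00.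
  have [_ _ e] := duP _ t0; exists (- du t) => //.
  by rewrite (linN lM0); apply/eqP; rewrite eq_sym -addr_eq0 addrC e.
have /choice[v vP] (t : R) : exists y : X, 0 <= t -> Defs.iota y = u t.
  have [t0|t0] := leP 0 t; last by exists 0.
  by exists (Subspace (mem_set (IVu _ t0 : carrier (IV M0 M1 clM0) _))).
pose x : X := Subspace (mem_set (IVu0 : carrier (IV M0 M1 clM0) u0)).
exists x, v; split=> //; split.
- apply/subspace_continuousP => s s0; apply/cvg_nrmP => e e0.
  have /subspace_continuousP/(_ s s0)/cvg_nrmP/(_ _ e0) := cu.
  rewrite !near_withinE; apply: filterS => t h t0; move: (h t0).
  move: s0 t0; rewrite /= !in_itv/= !andbT => s0 t0.
  by rewrite /from_subspace -(vP _ s0) -(vP _ t0).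
- by apply: val_inj => /=; rewrite (vP 0).
move=> t t0; have [tdu _ e] := duP _ t0.
have near_t : \forall h \near (0 : R)^', 0 <= t + h.
  have : \forall h \near (0 : R)^', `|h| < t by exact: dnbhs0_lt.
  apply: filterS => h; rewrite ltr_norml => /andP[h1 _].
  by rewrite -lerBlDl sub0r ltW.
have q h : 0 <= t + h -> Defs.iota ((h^-1)%:C *: (v (t + h) - v t)) =
    (h^-1)%:C *: (u (t + h) - u t).
  by move=> th; rewrite -[LHS]/(_ *: (Defs.iota _ - Defs.iota _)) !vP// ltW.
have IVdu : IV_set M0 M1 (du t).
  apply: (nrm_closed (IV_closed M0 M1 clM0)) => d d0.
  have /time_derivativeP/(_ _ d0) nd := tdu.
  near (0 : R)^' => h.
  exists ((h^-1)%:C *: (u (t + h) - u t)); last by near: h.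
  rewrite -q; first exact: iota_IV.
  by near: h.
pose y : X := Subspace (mem_set (IVdu : carrier (IV M0 M1 clM0) _)).
have yA : y = A (v t).
  apply: IV_injective; rewrite IV_operatorE /= vP ?ltW//.
  by apply/eqP; rewrite -addr_eq0 e.
apply/time_derivativeP => d d0; have /time_derivativeP/(_ _ d0) := tdu.
apply: filterS2 near_t => h th.
by rewrite -q// -yA.
Unshelve. all: by end_near. Qed.

End regular_pencil.

(** * The two equivalences *)

Section kernel_subspace.
Context {R : realType} {H : hilbertType R} (V : closedSubspace H).
Variables (Q : subspace_type V -> subspace_type V) (c : R).
Hypotheses (lQ : linear Q) (c0 : 0 < c) (Qc : bounded_by c Q).

(** Range and kernel of a projection [P] are the kernels of [1 - P] and [P], so
one construction yields both as closed subspaces of the whole space. *)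
Definition kernel_set : set H := [set h | exists2 x, Defs.iota x = h & Q x = 0].

Lemma kernel_set0 : kernel_set 0.
Proof. by exists 0 => //; exact: lin0. Qed.

Lemma kernel_setP (a : R[i]) x y :
  kernel_set x -> kernel_set y -> kernel_set (a *: x + y).
Proof.
move=> [u <- Qu] [v <- Qv]; exists (a *: u + v) => //.
by rewrite lQ Qu Qv scaler0 addr0.
Qed.

Lemma kernel_set_closed : closed kernel_set.
Proof.
apply: closed_nrm => l lQ0.
have Vl : carrier V l.
  apply: (nrm_closed (@carrier_closed _ _ V)) => e e0.
  have [_ [x <- _] xl] := lQ0 e e0.
  by exists (Defs.iota x) => //; exact/set_mem/(valP x).
pose y : subspace_type V := Subspace (mem_set Vl).
exists y => //; apply: nrm_le0_eq0; rewrite leNgt; apply/negP => Qy.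
have [_ [x <- Qx] xl] := lQ0 _ (divr_gt0 Qy c0).
have := Qc (y - x); rewrite (linB lQ) Qx subr0 leNgt => /negP; apply.
by rewrite mulrC -ltr_pdivlMr//.
Qed.

Definition kernel_subspace : closedSubspace H :=
  ClosedSubspace kernel_set0 kernel_setP kernel_set_closed.

End kernel_subspace.

Section equivalences.
Context {R : realType} {H : hilbertType R}.
Variables (M0 M1 : boundedOp H H) (clM0 : closed (range M0)).
Hypothesis reg : regular M0 M1.

Let X := subspace_type (IV M0 M1 clM0).
Let A : X -> X := IV_operator M0 M1 clM0.
Let lA : linear A. Proof. exact: linear_IV_operator. Qed.

(** The dichotomy is pulled back along the embedding of IV. *)
Lemma dichotomy_no_spectrum (S T : closedSubspace H) (z : R[i]) :
  strong_dichotomy_on M0 M1 clM0 S T ->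
  complex.Re z = 0 \/ (T `<=` [set 0]) /\ 0 <= complex.Re z ->
  ~ sigma_IV M0 M1 clM0 z.
Proof.
move=> [[SIV TIV invS invT] sumST _ [rho [C1 [C2 [rho0 C10 C20 est]]]]] zP.
have [c c0 Ac] := bounded_IV_operator clM0 reg.
apply/(spectrumPn _ lA).
pose pre (Q : closedSubspace H) : set X := [set x | carrier Q (Defs.iota x)].
have clP Q : closed (pre Q).
  apply: closed_nrm => l lQ.
  apply: (nrm_closed (@carrier_closed _ _ Q)) => e e0.
  by have [x Qx xl] := lQ e e0; exists (Defs.iota x).
have linQ Q (a : R[i]) x y : pre Q x -> pre Q y -> pre Q (a *: x + y).
  exact: (@carrierP _ _ Q).
have invQ (Q : closedSubspace H) :
    Defs.invariant M0 M1 Q -> flow_invariant A (pre Q).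
  by move=> iQ x u Qx ux t t0; apply: iQ Qx (flow_strong_solution reg ux) _ t0.
apply: (@dichotomy_resolvent _ _ A c lA c0 Ac (pre S) (pre T) rho C1 C2
  (clP S) (clP T) (linQ S) (linQ T) (invQ S invS) (invQ T invT)) => //.
- move=> x; have := iota_IV x.
  rewrite -[IV_set M0 M1]/(carrier (IV M0 M1 clM0)) -sumST => -[s Ss [r Tr srx]].
  exists (Subspace (mem_set (SIV _ Ss))), (Subspace (mem_set (TIV _ Tr))).
  by split=> //; apply: val_inj; rewrite /= -srx.
- move=> x u t ux t0 Sx.
  have [+ _] := est _ _ (flow_strong_solution reg ux) t t0.
  by move=> /(_ Sx); rewrite !nrmE -rmorphM lecR.
- move=> x u t ux t0 Tx.
  have [_] := est _ _ (flow_strong_solution reg ux) t t0.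
  by move=> /(_ Tx); rewrite !nrmE -rmorphM lecR.
- case: zP => [?|[T0 z0]]; [by left|right; split=> // x Tx].
  by apply: val_inj; exact: T0 _ Tx.
Qed.

(** Range and kernel of the projection [P]; when the whole closed right half-plane
is free of spectrum, [P = 1]. *)
Lemma no_spectrum_dichotomy (full : bool) :
  (forall z, region full z -> ~ sigma_IV M0 M1 clM0 z) ->
  if full then strong_dichotomy_on M0 M1 clM0 (IV M0 M1 clM0) (zero_subspace H)
  else strong_exponential_dichotomy M0 M1 clM0.
Proof.
move=> nospec; have [c c0 Ac] := bounded_IV_operator clM0 reg.
have resA z : region full z -> boundedly_invertible (fun x => z *: x - A x).
  by move=> /nospec/(spectrumPn _ lA).
have [P [rho [K [[lP [C C0 PC] PP PA Pfull] [rho0 K0 est]]]]] :=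
  exponential_dichotomy lA c0 Ac resA.
have lQ : linear (fun x => x - P x).
  by move=> a x y; rewrite lP opprD addrACA scalerBr.
have Qc : bounded_by (1 + C) (fun x => x - P x).
  by move=> x; rewrite (le_trans (nrmB _ _))// mulrDl mul1r lerD2l PC.
have C10 : 0 < 1 + C by rewrite addr_gt0.
have QA x : A x - P (A x) = A (x - P x) by rewrite PA (linB lA).
have flow0 u t : flow A 0 u -> 0 <= t -> u t = 0.
  move=> u0 t0; apply/nrm_le0_eq0; rewrite leNgt; apply/negP => ut.
  have := flow_growth (ltW c0) Ac u0 t0; rewrite nrm0 expr0n/= mul0r.
  by rewrite leNgt exprn_gt0.
pose S := kernel_subspace lQ C10 Qc; pose T := kernel_subspace lP C0 PC.
have inv (Q : X -> X) b (lQ' : linear Q) (b0 : 0 < b) (Qb : bounded_by b Q) :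
    (forall x, Q (A x) = A (Q x)) ->
    Defs.invariant M0 M1 (kernel_subspace lQ' b0 Qb).
  move=> QA' _ u [x <- Qx] ux t t0.
  have [y [v [yx yv vu]]] := strong_solution_flow clM0 reg (iota_IV x) ux.
  have {}yx : y = x by apply: val_inj.
  have := flow_comp lQ' b0 Qb QA' yv.
  rewrite yx Qx => /flow0/(_ (ltW t0)) /= Qv.
  by exists (v t); rewrite ?vu// ltW.
have decay u0 u (t : R) : strong_solution M0 M1 u0 u -> 0 <= t ->
    carrier S u0 -> `|u t| <= (K * expR (- rho * t))%:C * `|u0|.
  move=> us t0 [x xu /eqP]; rewrite subr_eq0 => /eqP Px.
  have IVu0 : IV_set M0 M1 u0 by rewrite -xu; exact: iota_IV.
  have [y [v [yu yv vu]]] := strong_solution_flow clM0 reg IVu0 us.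
  have yx : y = x by apply: val_inj; rewrite /= yu xu.
  have [h _] := est _ _ _ yv t0.
  rewrite !nrmE -rmorphM lecR -vu// -xu -yx.
  by apply: h; rewrite yx.
have growth u0 u (t : R) : strong_solution M0 M1 u0 u -> 0 <= t ->
    carrier T u0 -> (K^-1 * expR (rho * t))%:C * `|u0| <= `|u t|.
  move=> us t0 [x xu Px].
  have IVu0 : IV_set M0 M1 u0 by rewrite -xu; exact: iota_IV.
  have [y [v [yu yv vu]]] := strong_solution_flow clM0 reg IVu0 us.
  have yx : y = x by apply: val_inj; rewrite /= yu xu.
  have [_ h] := est _ _ _ yv t0.
  rewrite !nrmE -rmorphM lecR -vu// -xu -yx.
  by apply: h; rewrite yx.
have dich : strong_dichotomy_on M0 M1 clM0 S T.
  split.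
  - split; [by move=> _ [x <- _]; exact: iota_IV|
            by move=> _ [x <- _]; exact: iota_IV|exact: inv|exact: inv].
  - apply/seteqP; split=> [_ [_ [x <- _] [_ [y <- _] <-]]|h hIV].
      exact: (iota_IV (x + y)).
    pose x : X := Subspace (mem_set hIV).
    exists (Defs.iota (P x)); first by exists (P x) => //; rewrite PP subrr.
    exists (Defs.iota (x - P x)).
      by exists (x - P x) => //; rewrite (linB lP) PP subrr.
    rewrite -[Defs.iota (x - P x)]/(Defs.iota x - Defs.iota (P x)).
    by rewrite addrC subrK.
  - apply/seteqP; split=> [_ [[x <- /eqP]]|_ ->]; last first.
      by split; exact: kernel_set0.
    rewrite subr_eq0 => /eqP xP [y yx Py].
    have {}yx : y = x by apply: val_inj.
    by rewrite xP -yx Py.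
  - exists rho, K, K^-1; split=> //; first by rewrite invr_gt0.
    by move=> u0 u us t t0; split; [exact: decay|exact: growth].
case: full Pfull {nospec resA} => [/(_ isT) Pid|_]; last by exists S, T.
have SIV u0 : IV_set M0 M1 u0 -> carrier S u0.
  move=> IVu0.
  exists (Subspace (mem_set (IVu0 : carrier (IV M0 M1 clM0) u0))) => //.
  by rewrite Pid subrr.
split.
- split=> //.
  + by move=> _ ->; exact: IV0.
  + move=> u0 u IVu0 us t t0.
    have [y [v [_ _ vu]]] := strong_solution_flow clM0 reg IVu0 us.
    by rewrite -vu ?(ltW t0)//; exact: iota_IV.
  + move=> _ u -> us t t0.
    have [y [v [y0 yv vu]]] := strong_solution_flow clM0 reg (IV0 M0 M1) us.
    have {}y0 : y = 0 by apply: val_inj.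
    by rewrite y0 in yv; rewrite -vu ?(ltW t0)// (flow0 _ _ yv (ltW t0)).
- apply/seteqP; split=> [_ [x IVx [_ -> <-]]|x IVx]; first by rewrite addr0.
  by exists x => //; exists 0; rewrite ?addr0.
- apply/seteqP; split=> [x []//|_ ->]; split=> //.
  exact: IV0.
- exists rho, K, K^-1; split=> //; first by rewrite invr_gt0.
  move=> u0 u us t t0; split; first by move=> /SIV; exact: decay.
  by move=> ->; rewrite normr0 mulr0.
Qed.

End equivalences.

Theorem theorem7p10 (R : realType) (H : hilbertType R)
    (M0 M1 : boundedOp H H) (clM0 : closed (range M0)) :
  regular M0 M1 ->
  (strong_exponential_dichotomy M0 M1 clM0 <->
     sigma_IV M0 M1 clM0 `&` [set z | complex.Re z = 0] = set0) /\
  (strongly_exponentially_stable M0 M1 clM0 <->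
     sigma_IV M0 M1 clM0 `<=` [set z | complex.Re z < 0]).
Proof.
move=> reg; split; split.
- move=> [S [T dich]]; apply/seteqP; split=> // z [zs z0].
  by apply: (dichotomy_no_spectrum reg dich) zs; left.
- move=> nospec; apply: (@no_spectrum_dichotomy _ _ _ _ clM0 reg false).
  move=> z [z0|[]//] zs.
  by suff : set0 z by []; rewrite -nospec; split.
- move=> stable z zs /=; rewrite ltNge; apply/negP => z0.
  by apply: (dichotomy_no_spectrum reg stable) zs; right; split.
- move=> nospec; apply: (@no_spectrum_dichotomy _ _ _ _ clM0 reg true).
  move=> z zr /nospec /=; apply/negP; rewrite -leNgt.
  by case: zr => [->|[]].
Qed.
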